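(* Let $p(\cdot)$ be a variable exponent on $\mathbb{R}^d$ and let $q,\alpha$ be constants with $1\le q\le\alpha\le p(\cdot)\le\infty$. Then $\mathcal{H}(p(\cdot),q,\alpha)$ is a normed Köthe space on $\mathbb{R}^d$ defined by $\sigma_{p(\cdot),q,\alpha}$.
   Context: $L^0$ is the set of (a.e.-equivalence classes of) measurable complex-valued functions on $\mathbb{R}^d$, and $L^0_+$ the set of its nonnegative elements. A variable exponent is a measurable function $p(\cdot):\mathbb{R}^d\to[1,\infty]$. $\|f\|_{p(\cdot)}=\inf\{\lambda>0:\int_{\mathbb{R}^d}(|f(x)|/\lambda)^{p(x)}dx\le1\}$ (for $p(x)=\infty$: $t^\infty=0$ if $0\le t\le1$, $t^\infty=\infty$ if $t>1$); $L^{p(\cdot)}$ is the set of measurable $f$ with $\|f\|_{p(\cdot)}<\infty$; $L^{p(\cdot)}_{\rm loc}$ is the set of measurable $f$ with $f\chi_K\in L^{p(\cdot)}$ for every compact $K$. For $k\in\mathbb{Z}^d$, $r>0$, $I_k^r=\prod_{j=1}^d[rk_j,r(k_j+1))$. $\|f\|_{p(\cdot),q}=\big\|\{\|f\chi_{I_k^1}\|_{p(\cdot)}\}_{k\in\mathbb{Z}^d}\big\|_{\ell^q}$ and $(L^{p(\cdot)},\ell^q)=\{f\in L^{p(\cdot)}_{\rm loc}:\|f\|_{p(\cdot),q}<\infty\}$. For $\rho>0$, $St_\rho^{(\alpha)}f(x)=\rho^{-d/\alpha}f(\rho^{-1}x)$ (with $d/\infty=0$). An $\mathfrak{h}$-decomposition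 of $f\in L^{p(\cdot)}_{\rm loc}$ is a sequence $\{(c_n,\rho_n,f_n)\}_{n\ge1}$ in $\mathbb{C}\times(0,\infty)\times(L^{p(\cdot)},\ell^q)$ with $\|f_n\|_{p(\cdot),q}\le1$ for all $n$, $\sum_{n\ge1}|c_n|<\infty$, and $f=\sum_{n\ge1}c_nSt_{\rho_n}^{(\alpha)}f_n$ in the sense of $L^{p(\cdot)}_{\rm loc}$. $\mathcal{H}(p(\cdot),q,\alpha)$ is the set of $f\in L^{p(\cdot)}_{\rm loc}$ having at least one $\mathfrak{h}$-decomposition. $\sigma_{p(\cdot),q,\alpha}(f)$ is the infimum of $\sum_{n\ge1}|c_n|$ over all $\mathfrak{h}$-decompositions of $f$, and $\sigma_{p(\cdot),q,\alpha}(f)=\infty$ if $f$ has none (in particular if $f\in L^0\setminus L^{p(\cdot)}_{\rm loc}$). A function norm on $\mathbb{R}^d$ is a map $\sigma:L^0_+\to[0,\infty]$ such that for all $f,g\in L^0_+$ and real $\lambda\ge0$: $\sigma(f)=0\iff f=0$; $\sigma(\lambda f)=\lambda\sigma(f)$; $\sigma(f+g)\le\sigma(f)+\sigma(g)$; $f\le g$ a.e. implies $\sigma(f)\le\sigma(g)$. The normed Köthe space on $\mathbb{R}^d$ defined by a function norm $\sigma$ is $\{f\in L^0:\sigma(|f|)<\infty\}$. *)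

(* Defs.v *)
From HB Require Import structures.
From mathcomp Require Import all_boot all_order all_algebra.
From mathcomp Require Import complex.
From mathcomp Require Import all_classical all_reals all_analysis.
From mathcomp Require Import measurable_realfun.

Set Implicit Arguments.
Unset Strict Implicit.
Unset Printing Implicit Defensive.
Import Order.TTheory GRing.Theory Num.Theory.
Import numFieldNormedType.Exports.

Local Open Scope classical_set_scope.
Local Open Scope complex_scope.
Local Open Scope ring_scope.
Local Open Scope ereal_scope.

(* MathComp-Analysis has Lebesgue measure on R only. On R^d = 'rV[R]_d it is
   obtained here as in textbooks: outer measure by countable covers by boxes,
   restricted to the sigma-algebra of Caratheodory measurable sets. *)
Section LebesgueRd.
Variables (R : realType) (d : nat).
Implicit Types (a b : 'rV[R]_d) (A : set 'rV[R]_d).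

Definition box a b : set 'rV[R]_d :=
  [set x | forall i, (a ord0 i <= x ord0 i < b ord0 i)%R].

Definition box_vol a b : R :=
  (\prod_(i < d) Num.max (b ord0 i - a ord0 i) 0)%R.

(* The index set D makes finite, and empty, families allowed. *)
Definition lebesgue_outer A : \bar R :=
  ereal_inf [set v | exists (D : set nat) (a b : nat -> 'rV[R]_d),
    A `<=` \bigcup_(k in D) box (a k) (b k) /\
    v = \esum_(k in D) (box_vol (a k) (b k))%:E].

Lemma box_vol_ge0 a b : 0 <= (box_vol a b)%:E.
Proof. by rewrite lee_fin; apply: prodr_ge0 => i _; rewrite le_max lexx orbT. Qed.

Let lebesgue_outer_ge0 A : 0 <= lebesgue_outer A.
Proof.
apply: le_ereal_inf_tmp => _ [D [a [b [_ ->]]]].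
by apply: esum_ge0 => k _; exact: box_vol_ge0.
Qed.

Let lebesgue_outer0 : lebesgue_outer set0 = 0.
Proof.
apply/eqP; rewrite eq_le lebesgue_outer_ge0 andbT.
apply: ereal_inf_lbound; exists set0, (fun=> 0%R), (fun=> 0%R).
by split; [exact: sub0set|rewrite esum_set0].
Qed.

Let le_lebesgue_outer :
  {homo lebesgue_outer : A B / A `<=` B >-> (A <= B)%E}.
Proof.
move=> A B AB; apply: ereal_inf_le_tmp => v [D [a [b [BD ->]]]].
by exists D, a, b; split => //; exact: subset_trans BD.
Qed.

Let lebesgue_outer_sigma_subadditive : sigma_subadditive lebesgue_outer.
Proof.
move=> A; have [[i ioo]|] := pselect (exists i, lebesgue_outer (A i) = +oo).
  rewrite (eseries_pinfty _ _ ioo) ?leey// => n _.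
  by rewrite -ltNye (lt_le_trans _ (lebesgue_outer_ge0 _)).
rewrite -forallNE => Aoo; apply/lee_addgt0Pr => e e0.
rewrite (le_trans _ (epsilon_trick _ _ (ltW e0)))//.
pose P n (c : set nat * ((nat -> 'rV[R]_d) * (nat -> 'rV[R]_d))) :=
  A n `<=` \bigcup_(k in c.1) box (c.2.1 k) (c.2.2 k) /\
  \esum_(k in c.1) (box_vol (c.2.1 k) (c.2.2 k))%:E <=
    lebesgue_outer (A n) + (e / (2 ^ n.+1)%:R)%:E.
have [c Pc] : {c & forall n, P n (c n)}.
  apply: (@choice _ _ P) => n.
  have en : (0 < e / (2 ^ n.+1)%:R)%R by rewrite divr_gt0// ltr0n expn_gt0.
  have fA : lebesgue_outer (A n) \is a fin_num.
    by rewrite ge0_fin_numE// ltey; apply/eqP/Aoo.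
  have [_ [D [a [b [AD ->]]]] lt_v] := lb_ereal_inf_adherent en fA.
  by exists (D, (a, b)); split => //=; exact: ltW.
pose D n := (c n).1.
pose v (ij : nat * nat) := box_vol ((c ij.1).2.1 ij.2) ((c ij.1).2.2 ij.2).
apply: (@le_trans _ _ (\esum_(ij in [set: nat] `*`` D) (v ij)%:E)).
  have /card_esym/ppcard_eqP[f] := card_nat2.
  apply: ereal_inf_lbound; exists (f @^-1` ([set: nat] `*`` D)).
  exists (fun k => (c (f k).1).2.1 (f k).2), (fun k => (c (f k).1).2.2 (f k).2).
  split.
    move=> x [n _ /(Pc n).1[k Dk xk]].
    by exists (f^-1%FUN (n, k)); rewrite /= ?invK ?inE.
  rewrite (reindex_esum (f @^-1` ([set: nat] `*`` D)) _ f)//.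
  split => [//|x y _ _|y Dy]; first by apply: inj; rewrite inE.
  by exists (f^-1%FUN y); rewrite /= ?invK ?inE.
rewrite -(esum_esum (a := fun i j => (v (i, j))%:E)); last first.
  by move=> *; exact: box_vol_ge0.
rewrite -nneseries_esumT; last first.
  by move=> n; apply: esum_ge0 => k _; exact: box_vol_ge0.
apply: lee_nneseries => [n _ _|n _]; last exact: (Pc n).2.
by apply: esum_ge0 => k _; exact: box_vol_ge0.
Qed.

HB.instance Definition _ := isOuterMeasure.Build R 'rV[R]_d lebesgue_outer
  lebesgue_outer0 lebesgue_outer_ge0 le_lebesgue_outer
  lebesgue_outer_sigma_subadditive.

(* R^d with the sigma-algebra of Lebesgue measurable sets *)
Definition Rd := caratheodory_type lebesgue_outer.

HB.instance Definition _ := Measurable.on Rd.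

Definition lebesgueRd : set Rd -> \bar R := lebesgue_outer.

HB.instance Definition _ := isMeasure.Build _ _ _ lebesgueRd
  (@caratheodory_measure0 _ _ lebesgue_outer)
  (@caratheodory_measure_ge0 _ _ lebesgue_outer)
  (@caratheodory_measure_sigma_additive _ _ lebesgue_outer).

End LebesgueRd.

Section VariableExponent.
Variables (R : realType) (d : nat).
Local Notation V := 'rV[R]_d.
Local Notation mu := (@lebesgueRd R d).
Implicit Types (f g : V -> R[i]) (p : V -> \bar R) (q alpha : \bar R).

(* Elements of L^0 are represented by functions V -> R[i], equality in L^0
   being equality mu-almost everywhere. *)
Definition L0 : set (V -> R[i]) := [set f |
  measurable_fun [set: Rd R d] (fun x => complex.Re (f x) : R) /\
  measurable_fun [set: Rd R d] (fun x => complex.Im (f x) : R)].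

(* In R[i], 0 <= z means that z is real and nonnegative. *)
Definition L0_nneg : set (V -> R[i]) := [set f |
  L0 f /\ \forall x \ae mu, (0 <= f x)%R].

Definition variable_exponent p : Prop :=
  measurable_fun [set: Rd R d] (p : Rd R d -> \bar R) /\ forall x, 1 <= p x.

(* t ^ r for t >= 0 and r in [1, +oo]; the value at r = -oo is junk *)
Definition epow (t : R) (r : \bar R) : \bar R :=
  match r with
  | s%:E => (t `^ s)%:E
  | +oo => if (t <= 1)%R then 0 else +oo
  | -oo => 0
  end.

Definition vnorm p f : \bar R :=
  ereal_inf [set l%:E | l in [set l : R | (0 < l)%R /\
    \int[mu]_x epow (Normc.normc (f x) / l) (p x) <= 1]].

(* f times the indicator of K *)
Definition cut (K : set V) f : V -> R[i] := patch (fun=> 0%R) K f.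

Definition Lp_loc p : set (V -> R[i]) := [set f |
  L0 f /\ forall K : set V, compact K -> vnorm p (cut K f) < +oo].

Definition cube (r : R) (k : 'rV[int]_d) : set V :=
  box (\row_j (r * (k ord0 j)%:~R))%R (\row_j (r * (k ord0 j + 1)%:~R))%R.

(* the l^q norm, 1 <= q <= +oo, of a family of elements of [0, +oo] *)
Definition lq_norm (I : choiceType) q (a : I -> \bar R) : \bar R :=
  match q with
  | s%:E => (\esum_(k in [set: I]) (a k `^ s)) `^ s^-1
  | +oo => ereal_sup (range a)
  | -oo => 0
  end.

Definition amalgam_norm p q f : \bar R :=
  lq_norm q (fun k => vnorm p (cut (cube 1 k) f)).

Definition amalgam p q : set (V -> R[i]) :=
  [set f | Lp_loc p f /\ amalgam_norm p q f < +oo].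

(* d / alpha, with d / oo = 0 *)
Definition dim_over alpha : R :=
  if alpha is a%:E then (d%:R / a)%R else 0%R.

Definition St alpha (rho : R) f : V -> R[i] :=
  fun x => ((rho `^ (- dim_over alpha))%:C * f (rho^-1 *: x))%R.

Definition abs_sum (c : nat -> R[i]) : \bar R :=
  \sum_(0 <= n <oo) (Normc.normc (c n))%:E.

(* Convergence in L^{p(.)}_loc is convergence to 0 of the norm of the remainder
   on every compact set. The dilates of the fn n need not lie in Lp_loc, so
   for each K finitely many of these norms may be infinite. *)
Definition h_decomposition p q alpha f
    (c : nat -> R[i]) (rho : nat -> R) (fn : nat -> V -> R[i]) : Prop :=
  [/\ forall n, (0 < rho n)%R,
      forall n, amalgam p q (fn n) /\ amalgam_norm p q (fn n) <= 1,
      abs_sum c < +oo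
    & forall K : set V, compact K ->
        (fun N => vnorm p (cut K (fun x =>
           f x - \sum_(0 <= n < N) c n * St alpha (rho n) (fn n) x)%R))
          @ \oo --> 0].

Definition Hspace p q alpha : set (V -> R[i]) := [set f |
  Lp_loc p f /\ exists c rho fn, h_decomposition p q alpha f c rho fn].

(* ereal_inf set0 = +oo, so sigma f = +oo if f has no decomposition *)
Definition sigma p q alpha f : \bar R :=
  ereal_inf [set s | Lp_loc p f /\ exists c rho fn,
    h_decomposition p q alpha f c rho fn /\ s = abs_sum c].

(* The second field says that S is well defined on L^0. *)
Record function_norm (S : (V -> R[i]) -> \bar R) : Prop := FunctionNorm {
  function_norm_ge0 : forall f, L0_nneg f -> 0 <= S f;
  function_norm_ae : forall f g, L0_nneg f -> L0_nneg g ->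
    (\forall x \ae mu, f x = g x) -> S f = S g;
  function_norm_eq0 : forall f, L0_nneg f ->
    (S f = 0 <-> \forall x \ae mu, f x = 0%R);
  function_normZ : forall f (l : R), L0_nneg f -> (0 <= l)%R ->
    S (fun x => l%:C * f x)%R = l%:E * S f;
  function_normD : forall f g, L0_nneg f -> L0_nneg g ->
    S (fun x => f x + g x)%R <= S f + S g;
  function_norm_le : forall f g, L0_nneg f -> L0_nneg g ->
    (\forall x \ae mu, (f x <= g x)%R) -> S f <= S g
}.

Definition koethe_space (S : (V -> R[i]) -> \bar R) : set (V -> R[i]) :=
  [set f | L0 f /\ S (fun x => `|f x|%R) < +oo].

End VariableExponent.

(* Main.v *)
From Pilot Require Import Defs.
From mathcomp Require Import all_boot all_order all_algebra.
From mathcomp Require Import complex.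
From mathcomp Require Import all_classical all_reals all_analysis.
From mathcomp Require Import measurable_realfun.
From mathcomp Require Import lra.

(** All properties but one come from manipulating decompositions, and the
    remaining one, that sigma f = 0 forces f = 0, from a local L^1 estimate.

    Domination. Let g = sum_n c_n St_(rho_n) f_n and |f| <= |g| almost
    everywhere. Then f = m g with m measurable and |m| <= 1, and since
    m St_rho h = St_rho (m(rho .) h), the functions m(rho_n .) f_n decompose f
    with the same c_n and rho_n; their amalgam norms have not increased
    ([h_decomposition_le]). Hence sigma f <= sigma g ([sigma_le_normc]). This
    single fact gives monotonicity, invariance under almost everywhere
    equality, and, as sigma f = sigma |f|, the description of the space of
    decomposable functions as a normed Koethe space. Homogeneity follows by
    scaling the coefficients ([sigma_scale]) and subadditivity by interleaving
    two decompositions ([sigmaD]).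

    Definiteness. On a unit cube, alpha <= p gives t^alpha <= 1 + t^p, so the
    L^alpha norm on the cube is at most a constant times the L^p norm; summing
    over the cubes with q <= alpha embeds the unit ball of the amalgam into a
    ball of L^alpha ([integral_amalgam]). Because St_rho is an isometry of
    L^alpha, the dilates of all elements of the unit ball stay in that ball
    ([integral_St_le]), and their integrals over a bounded box are bounded
    independently of rho ([integral_normc_St_le]). Convergence in L^p_loc
    implies convergence in L^1_loc, so the integral of |f| over a box is at
    most a constant times sum_n |c_n|, for every decomposition of f
    ([h_decomposition_L1]). If sigma f = 0, all these integrals vanish and
    f = 0 almost everywhere ([sigma_eq0_ae]). *)

Set Implicit Arguments.
Unset Strict Implicit.
Unset Printing Implicit Defensive.
Import Order.TTheory GRing.Theory Num.Theory.
Import numFieldNormedType.Exports.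

Local Notation cut := Pilot.Defs.cut.
Local Open Scope classical_set_scope.
Local Open Scope ereal_scope.

(** * Lebesgue measure on R^d: boxes and dilations *)

Section LebesgueMeasure.
Local Open Scope ring_scope.
Local Open Scope ereal_scope.
Context {R : realType}.

Lemma le_mul_ereal_inf (S : set (\bar R)) (c : R) (x : \bar R) : (0 < c)%R ->
  (forall v, S v -> x <= c%:E * v) -> x <= c%:E * ereal_inf S.
Proof.
move=> c0 h; rewrite -ereal_inf_pZl//; apply: le_ereal_inf_tmp => _ [v Sv <-].
exact: h.
Qed.

Lemma esum_mulr_le (T : choiceType) (D : set T) (c : R) (a : T -> \bar R) :
  (0 <= c)%R -> (forall i, 0 <= a i) ->
  \esum_(i in D) (c%:E * a i) <= c%:E * \esum_(i in D) a i.
Proof.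
move=> c0 a0; apply: ge_ereal_sup => _ [F [finF FD] <-].
rewrite -ge0_mule_fsumr//; apply: lee_wpmul2l; first by rewrite lee_fin.
by apply: esum_ge; exists F.
Qed.

Variable d : nat.
Local Notation V := 'rV[R]_d.
Local Notation mu := (@lebesgueRd R d).

Definition rv_set (a : V) (i : 'I_d) (c : R) : V :=
  \row_j (if j == i then c else a ord0 j).

(** Cutting a box by a hyperplane orthogonal to an axis yields two boxes, one of
    which may be degenerate; the positive parts in the definition of the volume
    make additivity hold in that case too. *)
Lemma box_vol_cut (a b : V) (i : 'I_d) (c : R) :
  box_vol a b = (box_vol a (rv_set b i (Num.min (b ord0 i) c)) +
                 box_vol (rv_set a i (Num.max (a ord0 i) c)) b)%R.
Proof.
have E (u v : V) : box_vol u v = (Num.max (v ord0 i - u ord0 i) 0 *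
    \prod_(j < d | j != i) Num.max (v ord0 j - u ord0 j) 0)%R.
  by rewrite /box_vol (bigD1 i).
rewrite !E !mxE eqxx.
under [X in (_ = _ * X + _)%R]eq_bigr => j /negbTE ji do rewrite mxE ji.
under [X in (_ = _ + _ * X)%R]eq_bigr => j /negbTE ji do rewrite mxE ji.
rewrite -mulrDl; congr (_ * _)%R.
by case: (leP (b ord0 i) c); case: (leP (a ord0 i) c); rewrite /Num.max;
  repeat case: ifP; move=> *; lra.
Qed.

(** Both sides of the hyperplane inherit, from any cover by boxes, covers whose
    total volumes add up to the given one, which is Caratheodory's criterion. *)
Lemma measurable_halfspace (i : 'I_d) (c : R) :
  measurable ([set x : V | (x ord0 i < c)%R] : set (Rd R d)).
Proof.
apply: le_caratheodory_measurable => X.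
apply: le_ereal_inf_tmp => _ [D [a [b [XD ->]]]].
under eq_esum => k _ do rewrite (box_vol_cut (a k) (b k) i c) EFinD.
rewrite esumD; [|by move=> *; exact: box_vol_ge0..].
apply: leeD; apply: ereal_inf_lbound.
- exists D, a, (fun k => rv_set (b k) i (Num.min (b k ord0 i) c)); split => //.
  move=> x [/XD[k Dk xk] /= xc]; exists k => // j.
  have /andP[aj bj] := xk j; rewrite aj/= mxE; case: eqP => // ->.
  by rewrite lt_min xc andbT; have /andP[] := xk i.
- exists D, (fun k => rv_set (a k) i (Num.max (a k ord0 i) c)), b; split => //.
  move=> x [/XD[k Dk xk] /= /negP]; rewrite -leNgt => xc; exists k => // j.
  have /andP[aj bj] := xk j; rewrite bj andbT mxE; case: eqP => // ->.
  by rewrite ge_max xc andbT; have /andP[] := xk i.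
Qed.

Lemma measurable_box (a b : V) : measurable (box a b : set (Rd R d)).
Proof.
have -> : (box a b : set (Rd R d)) = \bigcap_(i in [set: 'I_d])
   (~` [set x : V | (x ord0 i < a ord0 i)%R] `&`
      [set x : V | (x ord0 i < b ord0 i)%R]).
  apply/seteqP; split => x /=.
    move=> h i _; have /andP[ai bi] := h i; split => //=.
    by apply/negP; rewrite -leNgt.
  move=> h i; have [/= /negP] := h i I.
  by rewrite -leNgt => -> ->.
apply: fin_bigcap_measurable; first exact: finite_finset.
move=> i _; apply: measurableI; last exact: measurable_halfspace.
by apply: measurableC; exact: measurable_halfspace.
Qed.

Lemma lebesgueRd_box_le (a b : V) : mu (box a b) <= (box_vol a b)%:E.
Proof.
apply: ereal_inf_lbound; exists [set 0%N], (fun=> a), (fun=> b); split.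
  by move=> x xb; exists 0%N.
by rewrite esum_set1// box_vol_ge0.
Qed.

Lemma lebesgue_outer_dilate_le (r : R) (A : set V) : (0 < r)%R ->
  lebesgue_outer [set x | A (r^-1 *: x)%R] <= (r ^+ d)%:E * lebesgue_outer A.
Proof.
move=> r0; apply: le_mul_ereal_inf; first exact: exprn_gt0.
move=> _ [D [a [b [AD ->]]]].
apply: (@le_trans _ _ (\esum_(k in D) ((r ^+ d)%:E * (box_vol (a k) (b k))%:E))).
  apply: ereal_inf_lbound; exists D, (fun k => r *: a k)%R, (fun k => r *: b k)%R.
  split.
    move=> x /= /AD[k Dk xk]; exists k => // i; have := xk i.
    by rewrite !mxE mulrC ler_pdivlMr// ltr_pdivrMr// ![(_ * r)%R]mulrC.
  apply: eq_esum => k _; rewrite -EFinM; congr EFin.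
  rewrite /box_vol -[X in (r ^+ X)%R](card_ord d) -prodr_const -big_split/=.
  apply: eq_bigr => i _; rewrite !mxE -mulrBr.
  by rewrite maxr_pMr ?ltW// mulr0.
by apply: esum_mulr_le; [exact/exprn_ge0/ltW|move=> k; exact: box_vol_ge0].
Qed.

Lemma lebesgue_outer_dilate (r : R) (A : set V) : (0 < r)%R ->
  lebesgue_outer [set x | A (r^-1 *: x)%R] = (r ^+ d)%:E * lebesgue_outer A.
Proof.
move=> r0; apply/eqP; rewrite eq_le lebesgue_outer_dilate_le//=.
have ri0 : (0 < r^-1)%R by rewrite invr_gt0.
have := @lebesgue_outer_dilate_le r^-1 [set x | A (r^-1 *: x)%R] ri0.
rewrite /= (_ : [set x | _] = A); last first.
  by apply/seteqP; split => x /=; rewrite scalerA invrK mulVf ?gt_eqF// scale1r.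
move=> /(@lee_wpmul2l _ (r ^+ d)%:E); rewrite lee_fin (exprn_ge0 _ (ltW r0)) => /(_ isT).
by rewrite muleA -EFinM -exprMn divff ?gt_eqF// expr1n mul1e.
Qed.

(** The outer measure scales by the constant factor r ^+ d on all sets, so the
    Caratheodory splitting of a set transfers to its dilate. *)
Lemma measurable_dilate (r : R) : (0 < r)%R ->
  measurable_fun [set: Rd R d] ((fun x : V => r^-1 *: x)%R : Rd R d -> Rd R d).
Proof.
move=> r0 _ /= M mM; rewrite setTI; apply: le_caratheodory_measurable => X.
have E (Y : set V) : Y = [set x | ([set y | Y (r *: y)%R]) (r^-1 *: x)%R].
  by apply/seteqP; split => x /=; rewrite scalerA divff ?gt_eqF// scale1r.
rewrite /= (E (_ `&` _)) (E (X `&` ~` _)) {3}(E X) !lebesgue_outer_dilate//.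
rewrite -ge0_muleDr ?outer_measure_ge0//.
apply: lee_wpmul2l; first by rewrite lee_fin exprn_ge0// ltW.
rewrite (mM [set y | X (r *: y)%R]) le_eqVlt; apply/orP; left; apply/eqP.
rewrite [in RHS](_ : M = [set y | M (r^-1 *: (r *: y))%R]); last first.
  by apply/seteqP; split => x /=; rewrite scalerA mulVf ?gt_eqF// scale1r.
by [].
Qed.

(** Change of variables: the image of Lebesgue measure under x |-> r^-1 x is
    r ^+ d times Lebesgue measure. *)
Lemma integral_dilate (r : R) (w : Rd R d -> \bar R) : (0 < r)%R ->
  measurable_fun setT w -> (forall x, 0 <= w x) ->
  \int[mu]_x w (r^-1 *: (x : V))%R = (r ^+ d)%:E * \int[mu]_x w x.
Proof.
move=> r0 mw w0.
have rd0 : (0 <= r ^+ d)%R by rewrite exprn_ge0// ltW.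
rewrite -[LHS]/(\int[mu]_(x in (fun x : V => r^-1 *: x)%R @^-1` setT)
  (w \o (fun x : V => r^-1 *: x)%R) x).
rewrite -(ge0_integral_pushforward (measurable_dilate r0))//.
rewrite (eq_measure_integral (mscale (NngNum rd0) mu)); last first.
  by move=> mphi A mA _; exact: (lebesgue_outer_dilate A r0).
- exact: measurable_dilate.
- by rewrite ge0_integral_mscale.
Qed.

End LebesgueMeasure.

(** * Powers with exponents in [1, oo] *)

Section ExtendedPower.
Local Open Scope ring_scope.
Local Open Scope ereal_scope.
Context {R : realType}.
Implicit Types (s t : R) (r : \bar R).

Lemma epow_ge0 t r : 0 <= epow t r.
Proof. by case: r => [r| |]//=; [rewrite lee_fin powR_ge0|case: ifP]. Qed.

Lemma epow0 r : 1 <= r -> epow 0 r = 0.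
Proof.
case: r => [r| |]//=; last by rewrite ler01.
by rewrite lee_fin => r1; rewrite powR0// gt_eqF// (lt_le_trans _ r1).
Qed.

Lemma epow1 t : (0 <= t)%R -> epow t 1 = t%:E.
Proof. by move=> t0; rewrite /= powRr1. Qed.

Lemma le_epow s t r : 1 <= r -> (0 <= s <= t)%R -> epow s r <= epow t r.
Proof.
case: r => [r| |]//=; rewrite ?lee_fin.
  move=> r1 /andP[s0 st]; apply: ge0_ler_powR; rewrite ?nnegrE//.
  - exact: le_trans r1.
  - exact: le_trans st.
move=> _ /andP[_ st]; case: (leP t 1%R) => [t1|_].
  by rewrite (le_trans st t1).
by case: ifP; rewrite ?leey.
Qed.

(** A substitute for Hoelder's inequality on sets of finite measure: the term 1
    absorbs the values t <= 1, and for t > 1 the power increases with the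
    exponent. *)
Lemma epow_le_exponent t r r' : (0 <= t)%R -> 1 <= r -> r <= r' ->
  epow t r <= 1 + epow t r'.
Proof.
move=> t0 r1 rr'; case: (leP t 1%R) => t1.
  apply: (@le_trans _ _ 1); last by rewrite leeDl// epow_ge0.
  apply: (@le_trans _ _ (epow 1 r)); first by rewrite le_epow// t0.
  by case: r r1 {rr'} => [r| |]//= _; rewrite ?powR1// lexx.
apply: (@le_trans _ _ (epow t r')); last by rewrite leeDr.
have t1F : (t <= 1)%R = false by rewrite leNgt t1.
case: r' r r1 rr' => [r'| |] [r| |]//=; rewrite ?t1F ?leey// => _ rr'.
by rewrite lee_fin ler_powR// ltW.
Qed.

(** The fragment of convexity of t |-> t^r that is needed to compensate the sum
    of two modulars. *)
Lemma epow_half t r : (0 <= t)%R -> 1 <= r ->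
  epow (2^-1 * t) r <= 2^-1%:E * epow t r.
Proof.
move=> t0; case: r => [r| |]//=.
  rewrite lee_fin => r1; rewrite lee_fin powRM ?invr_ge0//.
  apply: ler_wpM2r; first exact: powR_ge0.
  by apply: ge1r_powR => //; lra.
move=> _; case: (leP t 1%R) => t1.
  by rewrite ifT ?mule0//; lra.
by rewrite mulry gtr0_sg ?invr_gt0// mul1e leey.
Qed.

Lemma measurable_epow d (T : measurableType d) (u : T -> R) (r : T -> \bar R) :
  measurable_fun setT u -> measurable_fun setT r -> (forall x, 1 <= r x) ->
  measurable_fun setT (fun x => epow (u x) (r x)).
Proof.
move=> mu mr r1.
have -> : (fun x => epow (u x) (r x)) = (fun x =>
    if r x < +oo then
      (if u x == 0%R then 0 else expR (fine (r x) * ln (u x)))%:E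
    else if (u x <= 1)%R then 0 else +oo).
  apply/funext => x; have := r1 x; case: (r x) => [a| |]//=.
  rewrite lee_fin ltry /powR => a1; case: eqP => //.
  by rewrite gt_eqF// (lt_le_trans _ a1).
apply: measurable_fun_ifT.
- apply: (measurable_fun_bool true); rewrite setTI.
  by have := emeasurable_fun_infty_o measurableT mr +oo; rewrite setTI.
- apply/measurable_EFinP; apply: measurable_fun_ifT => //.
    exact: measurable_fun_eqr.
  apply: measurableT_comp => //; apply: measurable_funM.
    exact: measurableT_comp.
  by apply: measurableT_comp => //; exact: measurable_ln.
- apply: measurable_fun_ifT => //; exact: measurable_fun_ler.
Qed.

End ExtendedPower.

(** * Measurable complex-valued functions *)

Section MeasurableComplex.
Local Open Scope complex_scope.
Local Open Scope ring_scope.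
Local Open Scope ereal_scope.
Context {R : realType} {d : nat}.
Local Notation V := 'rV[R]_d.
Implicit Types f g : V -> R[i].

Lemma normc_ge0 (z : R[i]) : (0 <= Normc.normc z)%R.
Proof. by case: z => a b /=; exact: sqrtr_ge0. Qed.

Lemma normc_real (l : R) : (0 <= l)%R -> Normc.normc l%:C%C = l.
Proof. by move=> l0; rewrite /= expr0n/= addr0 sqrtr_sqr ger0_norm. Qed.

Lemma normc_norm (z : R[i]) : `|z|%R = (Normc.normc z)%:C%C.
Proof. by rewrite normc_def; case: z. Qed.

Lemma L0D f g : L0 f -> L0 g -> L0 (fun x => f x + g x)%R.
Proof.
move=> [fr fi] [gr gi]; split.
  by rewrite (_ : (fun x => _) = (fun x => complex.Re (f x) + complex.Re (g x))%R);
    [exact: measurable_funD|apply/funext => x; case: (f x); case: (g x)].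
by rewrite (_ : (fun x => _) = (fun x => complex.Im (f x) + complex.Im (g x))%R);
  [exact: measurable_funD|apply/funext => x; case: (f x); case: (g x)].
Qed.

Lemma L0M f g : L0 f -> L0 g -> L0 (fun x => f x * g x)%R.
Proof.
move=> [fr fi] [gr gi]; split.
  rewrite (_ : (fun x => _) = (fun x =>
      complex.Re (f x) * complex.Re (g x) - complex.Im (f x) * complex.Im (g x))%R).
    by apply: measurable_funB; exact: measurable_funM.
  by apply/funext => x; case: (f x); case: (g x).
rewrite (_ : (fun x => _) = (fun x =>
    complex.Re (f x) * complex.Im (g x) + complex.Im (f x) * complex.Re (g x))%R).
  by apply: measurable_funD; exact: measurable_funM.
by apply/funext => x; case: (f x); case: (g x).
Qed.

Lemma L0_cst (z : R[i]) : L0 (fun _ : V => z).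
Proof. by split. Qed.

Lemma L0_real (u : V -> R) : measurable_fun [set: Rd R d] u ->
  L0 (fun x => (u x)%:C)%C.
Proof. by move=> mu; split. Qed.

Lemma L0_normc f : L0 f ->
  measurable_fun [set: Rd R d] (fun x => Normc.normc (f x)).
Proof.
move=> [fr fi].
rewrite (_ : (fun x => _) = (fun x =>
    (complex.Re (f x) ^+ 2 + complex.Im (f x) ^+ 2) `^ 2^-1)%R).
  apply: (measurableT_comp (@measurable_powR R 2^-1)).
  by apply: measurable_funD; exact: measurable_funX.
by apply/funext => x; rewrite powR12_sqrt ?addr_ge0 ?sqr_ge0//; case: (f x).
Qed.

Lemma L0_normc_scale (l : R) f : L0 f ->
  measurable_fun [set: Rd R d] (fun x => Normc.normc (f x) / l)%R.
Proof. by move=> /L0_normc mf; exact: (measurable_funM mf (measurable_cst _)). Qed.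

Lemma L0_inv f : L0 f -> L0 (fun x => (f x)^-1)%R.
Proof.
move=> L0f; have := L0_normc L0f; case: L0f => fr fi fn.
have mi : measurable_fun [set: Rd R d] (fun x => (Normc.normc (f x) ^+ 2)^-1)%R.
  rewrite (_ : (fun x => _) = (fun x => (Normc.normc (f x) ^+ 2) `^ (-1))%R).
    by apply: (measurableT_comp (@measurable_powR R (-1))); exact: measurable_funX.
  by apply/funext => x; rewrite powR_inv1// sqr_ge0.
split.
  rewrite (_ : (fun x => _) = (fun x =>
      complex.Re (f x) * (Normc.normc (f x) ^+ 2)^-1)%R).
    exact: measurable_funM.
  apply/funext => x; case: (f x) => a b /=.
  by rewrite sqr_sqrtr ?addr_ge0 ?sqr_ge0.
rewrite (_ : (fun x => _) = (fun x =>
    - (complex.Im (f x) * (Normc.normc (f x) ^+ 2)^-1))%R).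
  by apply: measurable_funN; exact: measurable_funM.
apply/funext => x; case: (f x) => a b /=.
by rewrite sqr_sqrtr ?addr_ge0 ?sqr_ge0.
Qed.

Lemma L0_if (b : V -> bool) f g : measurable_fun [set: Rd R d] b -> L0 f -> L0 g ->
  L0 (fun x => if b x then f x else g x).
Proof.
move=> mb [fr fi] [gr gi]; split.
  rewrite (_ : (fun x => _) = (fun x =>
      if b x then complex.Re (f x) else complex.Re (g x))).
    exact: measurable_fun_ifT.
  by apply/funext => x; case: (b x).
rewrite (_ : (fun x => _) = (fun x =>
    if b x then complex.Im (f x) else complex.Im (g x))).
  exact: measurable_fun_ifT.
by apply/funext => x; case: (b x).
Qed.

Lemma L0_cut (Q : set V) f : measurable (Q : set (Rd R d)) -> L0 f -> L0 (cut Q f).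
Proof.
move=> mQ L0f; apply: (@L0_if (fun x => x \in Q) f (fun=> 0%R) _ L0f (L0_cst 0%R)).
apply: (measurable_fun_bool true); rewrite setTI.
suff -> : (fun x : V => x \in Q) @^-1` [set true] = Q by [].
by apply/seteqP; split => x /=; [exact: set_mem|exact: mem_set].
Qed.

Lemma L0_dilate (r : R) f : (0 < r)%R -> L0 f -> L0 (fun x => f (r^-1 *: x))%R.
Proof.
by move=> r0 [fr fi]; have md := @measurable_dilate R d r r0; split;
  [exact: (measurableT_comp fr md)|exact: (measurableT_comp fi md)].
Qed.

Lemma L0_sum (F : nat -> V -> R[i]) (N : nat) : (forall n, L0 (F n)) ->
  L0 (fun x => \sum_(0 <= n < N) F n x)%R.
Proof.
move=> LF; elim: N => [|N IH].
  by under eq_fun do rewrite big_nil; exact: L0_cst.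
by under eq_fun do rewrite big_nat_recr//=; exact: L0D.
Qed.

Lemma L0_St (alpha : \bar R) (r : R) f : (0 < r)%R -> L0 f -> L0 (St alpha r f).
Proof. by move=> r0 Lf; apply: L0M; [exact: L0_cst|exact: L0_dilate]. Qed.

End MeasurableComplex.

(** * Exhaustion of R^d by boxes *)

Section CenteredBox.
Local Open Scope ring_scope.
Context {R : realType} {d : nat}.
Local Notation V := 'rV[R]_d.

(** Cofinal with the compact sets for inclusion, and visibly measurable, these
    boxes replace compact sets in all norm estimates. *)
Definition centered_box (m : nat) : set V :=
  box (const_mx (- m%:R)) (const_mx m%:R).

Lemma centered_boxP m (x : V) :
  centered_box m x <-> forall i, - m%:R <= x ord0 i < m%:R.
Proof. by split => h i; have := h i; rewrite !mxE. Qed.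

Lemma compact_sub_centered_box (K : set V) : compact K ->
  exists m, K `<=` centered_box m.
Proof.
move=> /compact_bounded[M [_ KM]]; exists (Num.truncn (M + 1)).+1 => x Kx.
apply/centered_boxP => i.
have xM : `|x ord0 i| <= M + 1.
  apply: le_trans (KM (M + 1) _ _ Kx); last by rewrite ltrDl.
  by rewrite [leRHS]/Num.norm /= mx_normrE; apply/bigmax_geP; right => /=;
    exists (ord0, i).
have {xM} : `|x ord0 i| < (Num.truncn (M + 1)).+1%:R.
  by apply: (le_lt_trans xM); exact: truncnS_gt.
by rewrite ltr_norml => /andP[/ltW -> ->].
Qed.

Lemma centered_box_sub_compact m : exists2 K : set V, compact K &
  centered_box m `<=` K.
Proof.
exists [set v : V | forall i, `[(- m%:R)%R, m%:R]%classic (v ord0 i)].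
  have := @rV_compact R d (fun=> `[(- m%:R)%R, m%:R]%classic).
  by apply => i; exact: segment_compact.
move=> x /centered_boxP xm i; have /andP[h1 h2] := xm i.
by rewrite /= in_itv/= h1 ltW.
Qed.

Lemma centered_box_cover (x : V) : exists m, centered_box m x.
Proof.
have [m xm] := compact_sub_centered_box (@compact_set1 _ x).
by exists m; apply: xm.
Qed.

Lemma measurable_centered_box m : measurable (centered_box m : set (Rd R d)).
Proof. exact: measurable_box. Qed.

Lemma lebesgueRd_centered_box m : (@lebesgueRd R d (centered_box m) < +oo)%E.
Proof. by apply: le_lt_trans (lebesgueRd_box_le _ _) _; rewrite ltry. Qed.

End CenteredBox.

(** * The norm with variable exponent *)

Section VariableNorm.
Local Open Scope complex_scope.
Local Open Scope ring_scope.
Local Open Scope ereal_scope.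
Context {R : realType} {d : nat}.
Local Notation V := 'rV[R]_d.
Local Notation mu := (@lebesgueRd R d).
Implicit Types (f g h : V -> R[i]) (p r : V -> \bar R) (K Q : set V).

(** The integral of a nonnegative function is a supremum over simple functions
    below it, hence monotone without measurability. Restrictions to arbitrary
    compact sets can thus be compared before knowing them to be measurable. *)
Lemma ge0_le_integral_nonmeasurable (u v : Rd R d -> \bar R) :
  (forall x, 0 <= u x) -> (forall x, u x <= v x) ->
  \int[mu]_x u x <= \int[mu]_x v x.
Proof.
move=> u0 uv; have v0 x : 0 <= v x by exact: le_trans (uv x).
rewrite !ge0_integralTE//; apply: le_ereal_sup => _ [s su <-]; exists s => // x.
exact: le_trans (uv x).
Qed.

Lemma ae_imply (P Q : V -> Prop) : (forall x, P x -> Q x) ->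
  (\forall x \ae mu, P x) -> \forall x \ae mu, Q x.
Proof.
have F : Filter (almost_everywhere mu) by apply: ae_filter_ringOfSetsType.
by move=> PQ; exact: (@filterS _ _ F).
Qed.

Lemma ae_imply2 (P Q S : V -> Prop) : (forall x, P x -> Q x -> S x) ->
  (\forall x \ae mu, P x) -> (\forall x \ae mu, Q x) -> \forall x \ae mu, S x.
Proof.
have F : Filter (almost_everywhere mu) by apply: ae_filter_ringOfSetsType.
by move=> PQ; exact: (@filterS2 _ _ F).
Qed.

Lemma normc_cut K f x :
  Normc.normc (cut K f x) = if x \in K then Normc.normc (f x) else 0%R.
Proof. by rewrite /cut /patch; case: ifP => // _; exact: Normc.normc0. Qed.

Lemma cut0 K : cut K (fun=> 0%R : R[i]) = (fun=> 0%R).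
Proof. by apply/funext => x; rewrite /cut /patch; case: ifP. Qed.

Definition modular p f (l : R) : \bar R :=
  \int[mu]_x epow (Normc.normc (f x) / l) (p x).

Lemma vnorm_ge0 p f : 0 <= vnorm p f.
Proof.
by apply: le_ereal_inf_tmp => _ [l [/ltW l0 _] <-]; rewrite lee_fin.
Qed.

Lemma vnorm_le_modular p f (l : R) : (0 < l)%R -> modular p f l <= 1 ->
  vnorm p f <= l%:E.
Proof. by move=> l0 fl; apply: ereal_inf_lbound; exists l. Qed.

Lemma vnorm_lt_modular p f x : vnorm p f < x ->
  exists l, [/\ (0 < l)%R, l%:E < x & modular p f l <= 1].
Proof. by move=> /ereal_inf_lt[_ [l [l0 fl] <-] lx]; exists l. Qed.

Lemma measurable_modular p f (l : R) : variable_exponent p -> L0 f ->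
  measurable_fun [set: Rd R d] (fun x => epow (Normc.normc (f x) / l) (p x)).
Proof.
by move=> [mp p1] Lf; exact: (measurable_epow (L0_normc_scale l Lf) mp p1).
Qed.

Lemma vnorm_le_scale p f g (C : R) : variable_exponent p -> (0 < C)%R ->
  (forall x, Normc.normc (f x) <= C * Normc.normc (g x))%R ->
  vnorm p f <= C%:E * vnorm p g.
Proof.
move=> [_ p1] C0 fg; apply: le_mul_ereal_inf => // _ [l [l0 gl] <-].
rewrite -EFinM; apply: vnorm_le_modular; first exact: mulr_gt0.
apply: le_trans gl; apply: ge0_le_integral_nonmeasurable => x.
  exact: epow_ge0.
apply: le_epow => //; rewrite divr_ge0 ?normc_ge0 ?(ltW (mulr_gt0 C0 l0))//=.
by rewrite ler_pdivrMr ?mulr_gt0// mulrCA divfK ?gt_eqF.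
Qed.

Lemma vnorm_le p f g : variable_exponent p ->
  (forall x, Normc.normc (f x) <= Normc.normc (g x))%R ->
  vnorm p f <= vnorm p g.
Proof.
move=> hp fg; rewrite -[leRHS]mul1e; apply: vnorm_le_scale => // x.
by rewrite mul1r.
Qed.

Lemma vnorm_le_ae p f g : variable_exponent p -> L0 f -> L0 g ->
  (\forall x \ae mu, Normc.normc (f x) <= Normc.normc (g x))%R ->
  vnorm p f <= vnorm p g.
Proof.
move=> hp Lf Lg fg; apply: le_ereal_inf_tmp => _ [l [l0 gl] <-].
apply: vnorm_le_modular => //; apply: le_trans gl.
apply: ae_ge0_le_integral.
- exact: measurableT.
- by move=> *; exact: epow_ge0.
- exact: (measurable_modular l hp Lf).
- by move=> *; exact: epow_ge0.
- exact: (measurable_modular l hp Lg).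
apply: ae_imply fg => x fgx _; apply: le_epow; first exact: hp.2.
by rewrite divr_ge0 ?normc_ge0 ?(ltW l0)//= ler_pM2r// invr_gt0.
Qed.

(** With t the maximum of |f|/l and |g|/l', the quotient |f + g| / (2 (l + l'))
    is at most t/2, and (t/2)^p <= (1/2) ((|f|/l)^p + (|g|/l')^p). The factor
    1/2 brings the sum of two modulars, each at most 1, back to at most 1. *)
Lemma vnorm_addr p f g (a b : R) : variable_exponent p -> L0 f -> L0 g ->
  vnorm p f < a%:E -> vnorm p g < b%:E ->
  vnorm p (fun x => f x + g x)%R <= (2 * (a + b))%:E.
Proof.
move=> hp Lf Lg /vnorm_lt_modular[l [l0 la fl]] /vnorm_lt_modular[l' [l'0 l'b gl]].
apply: (@le_trans _ _ (2 * (l + l'))%:E); last first.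
  by move: la l'b; rewrite !lte_fin lee_fin; lra.
have ll0 : (0 < l + l')%R by exact: addr_gt0.
apply: vnorm_le_modular; first by rewrite mulr_gt0.
apply: (@le_trans _ _ (\int[mu]_x (2^-1%:E *
  (epow (Normc.normc (f x) / l) (p x) + epow (Normc.normc (g x) / l') (p x))))).
  apply: ge0_le_integral_nonmeasurable => x; first exact: epow_ge0.
  set u : R := Normc.normc (f x); set v : R := Normc.normc (g x).
  have u0 : (0 <= u)%R := normc_ge0 _; have v0 : (0 <= v)%R := normc_ge0 _.
  have p1 := hp.2 x.
  pose t : R := (Num.max (u / l) (v / l'))%R.
  have t0 : (0 <= t)%R by rewrite le_max divr_ge0// ltW.
  apply: (@le_trans _ _ (epow (2^-1 * t) (p x))).
    apply: le_epow => //; rewrite divr_ge0 ?normc_ge0 ?mulr_ge0 ?(ltW ll0)//=.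
    rewrite invfM mulrCA ler_pM2l ?invr_gt0//.
    rewrite ler_pdivrMr//; apply: (le_trans (le_normcD (_ : Rcomplex R) _)).
    rewrite mulrDr lerD//.
      by rewrite -ler_pdivrMr// le_max lexx.
    by rewrite -ler_pdivrMr// le_max lexx orbT.
  apply: le_trans (epow_half t0 p1) _.
  apply: lee_wpmul2l; first by rewrite lee_fin invr_ge0.
  rewrite /t; case: (leP (u / l)%R (v / l')%R) => _.
    by rewrite leeDr// epow_ge0.
  by rewrite leeDl// epow_ge0.
have mf := measurable_modular l hp Lf; have mg := measurable_modular l' hp Lg.
rewrite ge0_integralZl; last 4 first.
- exact: measurableT.
- exact: (emeasurable_funD mf mg).
- by move=> x _; rewrite adde_ge0// epow_ge0.
- by rewrite lee_fin invr_ge0.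
rewrite (ge0_integralD _ measurableT _ mf _ mg);
  [|by move=> *; exact: epow_ge0..].
apply: (@le_trans _ _ (2^-1%:E * (1 + 1))).
  by apply: lee_wpmul2l; [rewrite lee_fin invr_ge0|exact: leeD].
by rewrite -EFinD -EFinM lee_fin; lra.
Qed.

Lemma integral_epow_le_exponent Q (u : V -> R) p r :
  measurable (Q : set (Rd R d)) -> measurable_fun [set: Rd R d] u ->
  (forall x, 0 <= u x)%R -> variable_exponent p -> variable_exponent r ->
  (\forall x \ae mu, p x <= r x) ->
  \int[mu]_(x in Q) epow (u x) (p x) <=
  mu Q + \int[mu]_(x in Q) epow (u x) (r x).
Proof.
move=> mQ mu_ u0 [mp p1] [mr r1] pr.
have me p' : measurable_fun [set: Rd R d] p' -> (forall x, 1 <= p' x) ->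
    measurable_fun (Q : set (Rd R d)) (fun x : Rd R d => epow (u x) (p' x)).
  by move=> mp' p'1; apply: measurable_funTS; exact: measurable_epow.
rewrite -[X in X + _]mul1e -(integral_cst mu mQ 1).
have m1 : measurable_fun (Q : set (Rd R d)) (cst 1 : Rd R d -> \bar R).
  exact: measurable_cst.
rewrite -(ge0_integralD _ mQ _ m1 _ (me r mr r1)); [|by []|]; last first.
  by move=> x _; exact: epow_ge0.
apply: (ae_ge0_le_integral mQ _ (me p mp p1) _ (emeasurable_funD m1 (me r mr r1))).
- by move=> x _; exact: epow_ge0.
- by move=> x _; rewrite adde_ge0// epow_ge0.
- by apply: ae_imply pr => x prx _; exact: epow_le_exponent.
Qed.

Lemma variable_exponent_cst (a : \bar R) : 1 <= a ->
  variable_exponent (fun _ : V => a).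
Proof. by move=> a1; split. Qed.

(** The case of exponent 1 in the comparison of modulars, applied to |h|/l. *)
Lemma integral_normc_le_modular Q h p (l : R) :
  measurable (Q : set (Rd R d)) -> L0 h -> variable_exponent p -> (0 < l)%R ->
  \int[mu]_(x in Q) (Normc.normc (h x))%:E <=
  l%:E * (mu Q + \int[mu]_(x in Q) epow (Normc.normc (h x) / l) (p x)).
Proof.
move=> mQ Lh hp l0.
have mh : measurable_fun [set: Rd R d] (fun x => Normc.normc (h x) / l)%R.
  exact: L0_normc_scale.
have hl0 x : (0 <= Normc.normc (h x) / l)%R by rewrite divr_ge0 ?normc_ge0 ?ltW.
have p1 : \forall x \ae mu, 1 <= p x by apply: aeW; exact: hp.2.
have := integral_epow_le_exponent mQ mh hl0 (variable_exponent_cst (lexx 1)) hp p1.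
move=> /(@lee_wpmul2l _ l%:E); rewrite lee_fin (ltW l0) => /(_ isT).
rewrite -ge0_integralZl; last 4 first.
- exact: mQ.
- apply: measurable_funTS; apply: (measurable_epow mh) => // x.
- by move=> x _; exact: epow_ge0.
- by rewrite lee_fin ltW.
by under eq_integral => x _ do rewrite epow1// -EFinM mulrC divfK ?gt_eqF//.
Qed.

Lemma integral_normc_le_cut Q h p (l : R) :
  measurable (Q : set (Rd R d)) -> L0 h -> variable_exponent p -> (0 < l)%R ->
  vnorm p (cut Q h) < l%:E ->
  \int[mu]_(x in Q) (Normc.normc (h x))%:E <= l%:E * (mu Q + 1).
Proof.
move=> mQ Lh hp l0 /vnorm_lt_modular[l' [l'0 l'l hl']].
have mQ0 : 0 <= mu Q by exact: measure_ge0.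
apply: le_trans (integral_normc_le_modular mQ Lh hp l'0) _.
apply: lee_pmul => //.
- by rewrite lee_fin ltW.
- by rewrite adde_ge0//; apply: integral_ge0 => x _; exact: epow_ge0.
- exact: ltW.
apply: leeD => //; apply: le_trans hl'.
rewrite /modular integral_mkcond; apply: ge0_le_integral_nonmeasurable => x.
  by rewrite patchE; case: ifP => // _; exact: epow_ge0.
by rewrite patchE normc_cut; case: ifP => _ //; exact: epow_ge0.
Qed.

End VariableNorm.

(** * Convergence in L^p_loc *)

Section LocalConvergence.
Local Open Scope complex_scope.
Local Open Scope ring_scope.
Local Open Scope ereal_scope.
Context {R : realType} {d : nat} {p : 'rV[R]_d -> \bar R}.
Hypothesis hp : variable_exponent p.
Local Notation V := 'rV[R]_d.
Local Notation mu := (@lebesgueRd R d).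
Implicit Types (f g : V -> R[i]) (K Q : set V) (h : nat -> V -> R[i]).

Lemma vnorm_cut_sub K Q f : K `<=` Q -> vnorm p (cut K f) <= vnorm p (cut Q f).
Proof.
move=> KQ; apply: vnorm_le => // x; rewrite !normc_cut.
case: ifPn => [/set_mem/KQ/mem_set ->//|_].
by case: ifP => // _; exact: normc_ge0.
Qed.

Lemma vnorm_cut_le_scale K f g (C : R) : (0 < C)%R ->
  (forall x, Normc.normc (f x) <= C * Normc.normc (g x))%R ->
  vnorm p (cut K f) <= C%:E * vnorm p (cut K g).
Proof.
move=> C0 fg; apply: vnorm_le_scale => // x; rewrite !normc_cut.
by case: ifP => // _; rewrite mulr0.
Qed.

Lemma vnorm_cut_le_ae Q f g : measurable (Q : set (Rd R d)) -> L0 f -> L0 g ->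
  (\forall x \ae mu, Normc.normc (f x) <= Normc.normc (g x))%R ->
  vnorm p (cut Q f) <= vnorm p (cut Q g).
Proof.
move=> mQ Lf Lg fg; apply: (vnorm_le_ae hp (L0_cut mQ Lf) (L0_cut mQ Lg)).
by apply: ae_imply fg => x fgx; rewrite !normc_cut; case: ifP.
Qed.

Lemma vnorm_cut_addr Q f g (a b : R) : measurable (Q : set (Rd R d)) ->
  L0 f -> L0 g -> vnorm p (cut Q f) < a%:E -> vnorm p (cut Q g) < b%:E ->
  vnorm p (cut Q (fun x => f x + g x)%R) <= (2 * (a + b))%:E.
Proof.
move=> mQ Lf Lg fa gb.
rewrite (_ : cut Q _ = (fun x => cut Q f x + cut Q g x)%R); last first.
  by apply/funext => x; rewrite /cut /patch; case: ifP => // _; rewrite addr0.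
exact: (vnorm_addr hp (L0_cut mQ Lf) (L0_cut mQ Lg) fa gb).
Qed.

Lemma Lp_locP f : Lp_loc p f <->
  L0 f /\ forall m, vnorm p (cut (centered_box m) f) < +oo.
Proof.
split=> [[Lf fK]|[Lf fm]]; split => //; [move=> m|move=> K cK].
  have [K cK mK] := @centered_box_sub_compact R d m.
  exact: le_lt_trans (vnorm_cut_sub f mK) (fK K cK).
have [m Km] := compact_sub_centered_box cK.
exact: le_lt_trans (vnorm_cut_sub f Km) (fm m).
Qed.

Lemma Lp_loc_le f g : L0 f -> Lp_loc p g ->
  (\forall x \ae mu, Normc.normc (f x) <= Normc.normc (g x))%R -> Lp_loc p f.
Proof.
move=> Lf /Lp_locP[Lg gm] fg; apply/Lp_locP; split; first exact: Lf.
move=> m; apply: le_lt_trans (gm m).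
exact: vnorm_cut_le_ae (measurable_centered_box m) Lf Lg fg.
Qed.

Lemma Lp_loc_scale f (l : R) : (0 <= l)%R -> Lp_loc p f ->
  Lp_loc p (fun x => l%:C * f x)%C%R.
Proof.
move=> l0 [Lf fK]; split=> [|K cK]; first by apply: (L0M (L0_cst _) Lf).
have l10 : (0 < l + 1)%R by rewrite ltr_wpDl.
apply: (@le_lt_trans _ _ ((l + 1)%:E * vnorm p (cut K f))).
  apply: vnorm_cut_le_scale => // x; rewrite Normc.normcM.
  by rewrite normc_real// ler_wpM2r ?normc_ge0// lerDl.
by rewrite lte_mul_pinfty ?fK// lee_fin ltW.
Qed.

Lemma Lp_locD f g : Lp_loc p f -> Lp_loc p g -> Lp_loc p (fun x => f x + g x)%R.
Proof.
move=> /Lp_locP[Lf fm] /Lp_locP[Lg gm]; apply/Lp_locP; split => [|m].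
  exact: (L0D Lf Lg).
have fin (h : V -> R[i]) : vnorm p (cut (centered_box m) h) < +oo ->
    vnorm p (cut (centered_box m) h) <
    (fine (vnorm p (cut (centered_box m) h)) + 1)%:E.
  move=> hoo; have hfin : vnorm p (cut (centered_box m) h) \is a fin_num.
    by rewrite ge0_fin_numE// vnorm_ge0.
  by rewrite EFinD fineK// lteDl// lte01.
apply: le_lt_trans (vnorm_cut_addr _ Lf Lg (fin _ (fm m)) (fin _ (gm m))) _.
  exact: measurable_centered_box.
exact: ltry.
Qed.

Definition local_cvg0 h : Prop := forall K : set V, compact K ->
  (fun N => vnorm p (cut K (h N))) @ \oo --> 0.

Lemma local_cvg0P h : local_cvg0 h <->
  forall m (e : R), (0 < e)%R -> exists N0, forall N, (N0 <= N)%N ->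
    vnorm p (cut (centered_box m) (h N)) < e%:E.
Proof.
split=> [hK m e e0|hm K cK].
  have [K cK mK] := @centered_box_sub_compact R d m.
  have /fine_cvgP[[N1 _ hN1] /cvgrPdist_lt/(_ e e0)[N2 _ hN2]] := hK K cK.
  exists (maxn N1 N2) => N; rewrite geq_max => /andP[/hN1 /= hf /hN2 /=].
  rewrite sub0r normrN (ger0_norm (fine_ge0 (vnorm_ge0 _ _))) -lte_fin (fineK hf).
  by apply: le_lt_trans; exact: vnorm_cut_sub.
have [m Km] := compact_sub_centered_box cK.
have hlt e : (0 < e)%R -> exists N0, forall N, (N0 <= N)%N ->
    vnorm p (cut K (h N)) < e%:E.
  move=> /(hm m)[N0 hN0]; exists N0 => N /hN0.
  by apply: le_lt_trans; exact: vnorm_cut_sub.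
apply/fine_cvgP; split.
  have [N0 hN0] := hlt 1%R ltr01; exists N0 => // N /hN0 /= h1.
  by rewrite (ge0_fin_numE (vnorm_ge0 _ _)); exact: lt_trans h1 (ltry _).
apply/cvgrPdist_lt => e e0; have [N0 hN0] := hlt e e0; exists N0 => // N /hN0 /= h1.
rewrite sub0r normrN (ger0_norm (fine_ge0 (vnorm_ge0 _ _))) -lte_fin fineK; first exact: h1.
by rewrite (ge0_fin_numE (vnorm_ge0 _ _)); exact: lt_trans h1 (ltry _).
Qed.

Lemma local_cvg0_le h h' : (forall N, L0 (h N)) -> (forall N, L0 (h' N)) ->
  (forall N, \forall x \ae mu, Normc.normc (h N x) <= Normc.normc (h' N x))%R ->
  local_cvg0 h' -> local_cvg0 h.
Proof.
move=> Lh Lh' hh' /local_cvg0P h'0; apply/local_cvg0P => m e /(h'0 m)[N0 hN0].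
exists N0 => N /hN0; apply: le_lt_trans.
exact: vnorm_cut_le_ae (measurable_centered_box m) (Lh N) (Lh' N) (hh' N).
Qed.

Lemma local_cvg0_scale h (z : R[i]) : local_cvg0 h ->
  local_cvg0 (fun N x => z * h N x)%R.
Proof.
move=> /local_cvg0P h0; apply/local_cvg0P => m e e0.
pose C := (Normc.normc z + 1)%R.
have C0 : (0 < C)%R by rewrite ltr_wpDl// normc_ge0.
have [N0 hN0] := h0 m (e / C)%R (divr_gt0 e0 C0).
exists N0 => N /hN0 hN; apply: (@le_lt_trans _ _
    (C%:E * vnorm p (cut (centered_box m) (h N)))).
  apply: vnorm_cut_le_scale => // x.
  by rewrite Normc.normcM ler_wpM2r ?normc_ge0// lerDl.
rewrite -(@divfK _ C _ e) ?gt_eqF// EFinM muleC.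
by rewrite lte_pmul2r.
Qed.

(** Adding the subsequences indexed by the two halves of N is what interleaving
    two series requires. *)
Lemma local_cvg0D h h' : (forall N, L0 (h N)) -> (forall N, L0 (h' N)) ->
  local_cvg0 h -> local_cvg0 h' ->
  local_cvg0 (fun N x => h (uphalf N) x + h' N./2 x)%R.
Proof.
move=> Lh Lh' /local_cvg0P h0 /local_cvg0P h'0; apply/local_cvg0P => m e e0.
(* the sum is bounded by 2 (e/5 + e/5) < e *)
have e5 : (0 < e / 5)%R by rewrite divr_gt0.
have [N0 hN0] := h0 m _ e5; have [N1 hN1] := h'0 m _ e5.
exists ((N0 + N1).*2)%N => N hN.
have le2 : (N0 + N1 <= N./2)%N by rewrite -(doubleK (N0 + N1)%N) half_leq.
have le3 : (N0 + N1 <= uphalf N)%N.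
  by rewrite (leq_trans le2)// uphalf_half leq_addl.
apply: le_lt_trans (vnorm_cut_addr (measurable_centered_box m)
  (Lh _) (Lh' _) (hN0 _ _) (hN1 _ _)) _.
- exact: leq_trans (leq_addr _ _) le3.
- exact: leq_trans (leq_addl _ _) le2.
- by rewrite lte_fin; lra.
Qed.

End LocalConvergence.

(** * Amalgam norms *)

Section Amalgam.
Local Open Scope ring_scope.
Local Open Scope ereal_scope.
Context {R : realType} {d : nat}.
Local Notation V := 'rV[R]_d.
Implicit Types (f g : V -> R[i]) (p : V -> \bar R) (q : \bar R).

Lemma le_lq_norm (I : choiceType) q (a b : I -> \bar R) : 1 <= q ->
  (forall k, 0 <= a k) -> (forall k, a k <= b k) -> lq_norm q a <= lq_norm q b.
Proof.
move=> q1 a0 ab; have b0 k : 0 <= b k by exact: le_trans (ab k).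
case: q q1 => [s| |]//=.
  rewrite lee_fin => s1; have s0 : (0 <= s)%R by exact: le_trans s1.
  have pow_le : \esum_(k in [set: I]) (a k `^ s) <= \esum_(k in [set: I]) (b k `^ s).
    by apply: le_esum => k _; apply: gt0_ler_poweR => //;
      rewrite in_itv/= ?a0 ?b0 leey.
  apply: gt0_ler_poweR => //; rewrite ?invr_ge0// in_itv/= leey andbT;
    by apply: esum_ge0 => k _; exact: poweR_ge0.
move=> _; apply: ge_ereal_sup => _ [k _ <-].
by apply: le_ereal_sup_tmp; exists (b k) => //; exists k.
Qed.

Lemma amalgam_le p q f g : variable_exponent p -> 1 <= q -> L0 f ->
  amalgam p q g -> (forall x, Normc.normc (f x) <= Normc.normc (g x))%R ->
  amalgam p q f /\ amalgam_norm p q f <= amalgam_norm p q g.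
Proof.
move=> hp q1 Lf [gloc gnorm] fg.
have fgn : amalgam_norm p q f <= amalgam_norm p q g.
  apply: (le_lq_norm q1) => k; first exact: vnorm_ge0.
  by apply: vnorm_le => // x; rewrite !normc_cut; case: ifP.
split; last exact: fgn.
split; last exact: le_lt_trans gnorm.
by apply: (Lp_loc_le hp Lf gloc); exact: aeW.
Qed.

Lemma vnorm0 p : variable_exponent p -> vnorm p (fun=> 0%R) = 0.
Proof.
move=> hp; apply/eqP; rewrite eq_le vnorm_ge0 andbT.
apply/lee_addgt0Pr => e e0; rewrite add0e; apply: vnorm_le_modular => //.
rewrite /modular; under eq_integral => x _ do rewrite Normc.normc0 mul0r epow0 ?hp.2//.
by rewrite integral0.
Qed.

Lemma amalgam0 p q : variable_exponent p -> 1 <= q ->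
  amalgam p q (fun=> 0%R) /\ amalgam_norm p q (fun=> 0%R) = 0.
Proof.
move=> hp q1.
suff n0 : amalgam_norm p q (fun=> 0%R) = 0.
  split; last exact: n0.
  split; last by rewrite n0.
  by split=> [|K _]; [exact: L0_cst|rewrite cut0 vnorm0].
rewrite /amalgam_norm; under [X in lq_norm q X]eq_fun do rewrite cut0 vnorm0//.
case: q q1 => [s| |]//=.
  rewrite lee_fin => s1; have s0 : (0 < s)%R by exact: lt_le_trans s1.
  rewrite esum1.
    by apply: poweR0r; rewrite invr_eq0 gt_eqF.
  by move=> k _; rewrite powR0// gt_eqF.
move=> _; rewrite (_ : range _ = [set 0]) ?ereal_sup1//.
apply/seteqP; split=> [_ [k _ <-]//|_ ->]; by exists 0%R.
Qed.

End Amalgam.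

(** * Uniform integral bounds for dilates of amalgam functions *)

Section Dilates.
Local Open Scope complex_scope.
Local Open Scope ring_scope.
Local Open Scope ereal_scope.
Context {R : realType} {d : nat}.
Local Notation V := 'rV[R]_d.
Local Notation mu := (@lebesgueRd R d).
Implicit Types (f g : V -> R[i]) (p : V -> \bar R) (q alpha : \bar R).

Lemma esum_pickle (I : countType) (c : I -> \bar R) : (forall k, 0 <= c k) ->
  \sum_(n <oo) (if pickle_inv n is Some k then c k else 0) =
  \esum_(k in [set: I]) c k.
Proof.
move=> c0; pose cc n := if pickle_inv n is Some k then c k else 0.
have cc0 n : 0 <= cc n by rewrite /cc; case: pickle_inv.
transitivity (\esum_(n in range (@pickle I)) cc n).
  rewrite nneseries_esumT// [RHS]esum_mkcond; apply: eq_esum => n _.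
  case: ifPn => // /negP nr; rewrite /cc.
  case E : (pickle_inv n) => [k|//]; exfalso; apply: nr; apply/mem_set.
  by exists k => //; have := @pickle_invK I n; rewrite E.
rewrite (reindex_esum [set: I] (range (@pickle I)) (@pickle I)).
  by apply: eq_esum => k _; rewrite /cc pickleK_inv.
split=> [k _|x y _ _|n [k _ <-]]; first by exists k.
  exact: (pcan_inj pickleK).
by exists k.
Qed.

Lemma integral_le_esum_cover (I : countType) (F : I -> set V)
    (w : Rd R d -> \bar R) (c : I -> \bar R) :
  (forall k, measurable (F k : set (Rd R d))) ->
  measurable_fun [set: Rd R d] w -> (forall x, 0 <= w x) ->
  (forall x, exists k, F k x) ->
  (forall k, \int[mu]_(x in F k) w x <= c k) ->
  \int[mu]_x w x <= \esum_(k in [set: I]) c k.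
Proof.
move=> mF mw w0 cov wc.
have c0 k : 0 <= c k by apply: le_trans (wc k); apply: integral_ge0.
pose G n : set (Rd R d) := if @pickle_inv I n is Some k then F k else set0.
have mG n : measurable (G n) by rewrite /G; case: pickle_inv.
have wG0 n x : 0 <= (w \_ (G n)) x by rewrite patchE; case: ifP.
have mwG n : measurable_fun [set: Rd R d] (w \_ (G n)).
  apply/(measurable_restrictT _ (mG n)); exact: measurable_funTS.
apply: (@le_trans _ _ (\int[mu]_x \sum_(n <oo) (w \_ (G n)) x)).
  apply: ge0_le_integral_nonmeasurable => // x; have [k Fk] := cov x.
  rewrite (@nneseriesD1 _ _ (pickle k))//.
  rewrite patchE ifT; last by rewrite inE /G pickleK_inv.
  by rewrite leeDl//; apply: nneseries_ge0.
rewrite integral_nneseries// -esum_pickle//.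
apply: lee_nneseries => [n _ _|n _]; first exact: integral_ge0.
rewrite -integral_mkcond /G; case: pickle_inv => [k|]; first exact: wc.
by rewrite integral_set0.
Qed.

Lemma cube_cover (x : V) : exists k, cube 1 k x.
Proof.
exists (\row_j Num.floor (x ord0 j))%R => i.
by rewrite !mxE !mul1r; exact: floor_itv.
Qed.

Lemma measurable_cube (k : 'rV[int]_d) : measurable (cube 1 k : set (Rd R d)).
Proof. exact: measurable_box. Qed.

Lemma lebesgueRd_cube_le1 (k : 'rV[int]_d) : mu (cube 1 k) <= 1.
Proof.
apply: le_trans (lebesgueRd_box_le _ _) _; rewrite lee_fin /box_vol.
rewrite big1// => i _; rewrite !mxE !mul1r intrD [(_ + 1%:~R)%R]addrC addrK.
by rewrite max_l.
Qed.

(** At the exponent oo the integrand takes only the values 0 and oo, so it equals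
    twice itself and its integral, if finite, is 0. *)
Lemma integral_epow_infty0 (Q : set V) (u : V -> R) :
  measurable (Q : set (Rd R d)) -> measurable_fun [set: Rd R d] u ->
  \int[mu]_(x in Q) epow (u x) +oo < +oo ->
  \int[mu]_(x in Q) epow (u x) +oo = 0.
Proof.
move=> mQ mu_; set J := \int[mu]_(x in Q) _ => Joo.
have J0 : 0 <= J by apply: integral_ge0 => x _; exact: epow_ge0.
have : 2%:E * J = J.
  rewrite /J -ge0_integralZl; last 4 first.
  - exact: mQ.
  - apply: measurable_funTS; apply: (measurable_epow mu_ (measurable_cst _)).
    by move=> x; exact: leey.
  - by move=> x _; exact: epow_ge0.
  - by rewrite lee_fin.
  by apply: eq_integral => x _ /=; case: ifP => _; rewrite ?mule0// gt0_muley.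
have /fineK <- : J \is a fin_num by rewrite ge0_fin_numE.
by rewrite -EFinM => -[] h; congr EFin; lra.
Qed.

Lemma vnorm_cube_le1 p q g : variable_exponent p -> 1 <= q ->
  amalgam_norm p q g <= 1 ->
  (forall k, vnorm p (cut (cube 1 k) g) <= 1) /\
  (forall s, q = s%:E ->
     \esum_(k in [set: 'rV[int]_d]) vnorm p (cut (cube 1 k) g) `^ s <= 1).
Proof.
rewrite /amalgam_norm => hp; set a := fun k => _.
have a0 k : 0 <= a k by exact: vnorm_ge0.
case: q => [s| |]//=; last first.
  by move=> _ h; split=> // k; apply: le_trans h; apply: ereal_sup_ubound; exists k.
rewrite lee_fin => s1 h; have s0 : (0 < s)%R by exact: lt_le_trans s1.
have root_le (x : \bar R) (t : R) : (0 < t)%R -> 0 <= x -> x `^ t <= 1 -> x <= 1.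
  move=> t0 x0 xt; have -> : x = (x `^ t) `^ t^-1.
    by rewrite -poweRrM divff ?gt_eqF// poweRe1.
  rewrite -[leRHS](poweR1r t^-1); apply: gt0_ler_poweR => //.
  - by rewrite invr_ge0 ltW.
  - by rewrite in_itv/= poweR_ge0 leey.
  - by rewrite in_itv/= lee01 leey.
have sum1 : \esum_(k in [set: 'rV[int]_d]) a k `^ s <= 1.
  apply: (root_le _ s^-1%R); rewrite ?invr_gt0//.
  by apply: esum_ge0 => k _; exact: poweR_ge0.
split=> [k|_ [<-]//]; apply: (root_le _ s s0 (a0 k)); apply: le_trans sum1.
apply: esum_ge; exists [set k]; first by split=> //; exact: finite_set1.
by rewrite fsbig_set1.
Qed.

Lemma integral_modular_cube p alpha g (k : 'rV[int]_d) (l : R) :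
  variable_exponent p -> 1 <= alpha -> (\forall x \ae mu, alpha <= p x) ->
  L0 g -> (0 < l)%R -> modular p (cut (cube 1 k) g) l <= 1 ->
  \int[mu]_(x in cube 1 k) epow (Normc.normc (g x) / l) alpha <= 2%:E.
Proof.
move=> hp a1 ap Lg l0 gl.
apply: le_trans (integral_epow_le_exponent (measurable_cube k) _ _
  (variable_exponent_cst a1) hp ap) _.
- exact: L0_normc_scale.
- by move=> x; rewrite divr_ge0 ?normc_ge0 ?ltW.
rewrite (_ : 2%:E = 1 + 1); last by rewrite -EFinD.
apply: leeD; first exact: lebesgueRd_cube_le1.
apply: le_trans gl; rewrite /modular integral_mkcond.
apply: ge0_le_integral_nonmeasurable => x.
  by rewrite patchE; case: ifP => // _; exact: epow_ge0.
by rewrite patchE normc_cut; case: ifP => _ //; exact: epow_ge0.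
Qed.

(** The modular bound at each admissible l reads (J/2)^(1/s) <= l, where J is the
    integral. Taking the infimum over l in this form gives the bound at the norm
    itself, whether or not the infimum is attained. *)
Lemma integral_pow_cube p (s : R) g (k : 'rV[int]_d) :
  variable_exponent p -> (1 <= s)%R -> (\forall x \ae mu, s%:E <= p x) ->
  L0 g ->
  \int[mu]_(x in cube 1 k) epow (Normc.normc (g x)) s%:E <=
  2%:E * vnorm p (cut (cube 1 k) g) `^ s.
Proof.
move=> hp s1 sp Lg; set J := \int[mu]_(x in _) _.
have s0 : (0 < s)%R by exact: lt_le_trans s1.
have J0 : 0 <= J by apply: integral_ge0 => x _; exact: epow_ge0.
have hJ0 : 0 <= 2^-1%:E * J by rewrite mule_ge0// lee_fin invr_ge0.
suff h : (2^-1%:E * J) `^ s^-1 <= vnorm p (cut (cube 1 k) g).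
  have -> : J = 2%:E * (2^-1%:E * J).
    by rewrite muleA -EFinM divff// mul1e.
  apply: lee_wpmul2l => //.
  have -> : 2^-1%:E * J = ((2^-1%:E * J) `^ s^-1) `^ s.
    by rewrite -poweRrM mulVf ?gt_eqF// poweRe1.
  apply: gt0_ler_poweR => //; first exact: ltW.
  - by rewrite in_itv/= poweR_ge0 leey.
  - by rewrite in_itv/= vnorm_ge0 leey.
apply: le_ereal_inf_tmp => _ [l [l0 gl] <-].
have -> : l%:E = (l%:E `^ s) `^ s^-1.
  by rewrite -poweRrM divff ?gt_eqF// poweRe1// lee_fin ltW.
have ls0 : (0 < l `^ s)%R by exact: powR_gt0.
apply: gt0_ler_poweR; rewrite ?invr_ge0 ?(ltW s0)// ?in_itv/= ?hJ0 ?leey//.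
  by rewrite lee_fin ltW.
have := integral_modular_cube hp (_ : 1 <= s%:E) sp Lg l0 gl.
rewrite lee_fin => /(_ s1).
have -> : \int[mu]_(x in cube 1 k) epow (Normc.normc (g x) / l) s%:E =
    (l `^ s)^-1%:E * J.
  rewrite /J -ge0_integralZl; last 4 first.
  - exact: measurable_cube.
  - apply: measurable_funTS.
    exact: (measurable_epow (L0_normc Lg) (measurable_cst _) (fun=> (s1 : 1 <= s%:E))).
  - by move=> x _; exact: epow_ge0.
  - by rewrite lee_fin invr_ge0 ltW.
  apply: eq_integral => x _ /=; rewrite -EFinM; congr EFin.
  by rewrite powRM ?normc_ge0 ?invr_ge0 ?(ltW l0)// mulrC -powR_inv1 ?ltW//
    -powRrM mulN1r powRN.
move=> h; have := @lee_wpmul2l _ (l `^ s / 2)%:E _ _ _ h.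
rewrite lee_fin divr_ge0 ?(ltW ls0)// => /(_ isT).
by rewrite muleA -!EFinM divfK// mulrAC divff ?gt_eqF// mul1r.
Qed.

(** Halving |g| matters only for alpha = oo: a norm at most 1 gives a modular at
    most 1 for some l < 2, which then bounds |g| by 2 almost everywhere. For
    finite alpha, the norms on the cubes are at most 1, so their alpha-th powers
    are dominated by their q-th powers, whose sum is at most 1. *)
Lemma integral_amalgam p q alpha g : variable_exponent p ->
  1 <= q -> q <= alpha -> (\forall x \ae mu, alpha <= p x) -> L0 g ->
  amalgam_norm p q g <= 1 ->
  \int[mu]_x epow (Normc.normc (g x) / 2) alpha <= 2%:E.
Proof.
move=> hp q1 qa ap Lg g1; have a1 : 1 <= alpha by exact: le_trans qa.
have [lam1 lamq] := vnorm_cube_le1 hp q1 g1.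
have mg := L0_normc_scale 2 Lg.
have mw : measurable_fun [set: Rd R d]
    (fun x => epow (Normc.normc (g x) / 2) alpha).
  exact: (measurable_epow mg (measurable_cst _) (fun=> a1)).
case: alpha a1 qa ap mw => [s| |] a1 qa ap mw.
- case: q q1 qa lamq {g1} => [t| |]// t1 ts /(_ t erefl) sum1.
  rewrite !lee_fin in a1 t1 ts.
  apply: (@le_trans _ _ (\esum_(k in [set: 'rV[int]_d])
      (2%:E * vnorm p (cut (cube 1 k) g) `^ t))); last first.
    apply: le_trans (esum_mulr_le _ _ _) _ => //.
      by move=> k; exact: poweR_ge0.
    by rewrite -[leRHS]mule1; apply: lee_wpmul2l.
  apply: (integral_le_esum_cover measurable_cube mw) => [x|x|k].
  + exact: epow_ge0.
  + exact: cube_cover.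
  apply: (@le_trans _ _ (\int[mu]_(x in cube 1 k) epow (Normc.normc (g x)) s%:E)).
    apply: ge0_le_integral; first exact: measurable_cube.
    + by move=> x _; exact: epow_ge0.
    + exact: (measurable_funTS mw).
    + apply: measurable_funTS.
      exact: (measurable_epow (L0_normc Lg) (measurable_cst _) (fun=> (a1 : 1 <= s%:E))).
    + move=> x _; apply: le_epow => //; rewrite divr_ge0 ?normc_ge0//=.
      by have := normc_ge0 (g x); lra.
  have H1 := integral_pow_cube k hp a1 ap Lg. apply: (le_trans H1); apply: lee_wpmul2l => //.
  have := lam1 k; have := vnorm_ge0 p (cut (cube 1 k) g).
  case: (vnorm _ _) => [l| |]//=; rewrite !lee_fin => l0 l1.
  move: l0; rewrite le_eqVlt => /predU1P[<-|l0].
    by rewrite !powR0// gt_eqF// ?(lt_le_trans _ t1)// (lt_le_trans _ a1).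
  by apply: ger_powR => //; rewrite l0.
- apply: (@le_trans _ _ (\esum_(k in [set: 'rV[int]_d]) 0)); last by rewrite esum1.
  apply: (integral_le_esum_cover measurable_cube mw) => [x|x|k].
  + exact: epow_ge0.
  + exact: cube_cover.
  have lam2 : vnorm p (cut (cube 1 k) g) < 2%:E.
    by apply: le_lt_trans (lam1 k) _; rewrite lte_fin ltr1n.
  have [l [l0 l2 gl]] := vnorm_lt_modular lam2.
  rewrite integral_epow_infty0//; first exact: measurable_cube.
  apply: (@le_lt_trans _ _ 2%:E); last exact: ltry.
  have := integral_modular_cube hp a1 ap Lg l0 gl; apply: le_trans.
  apply: ge0_le_integral; first exact: measurable_cube.
  + by move=> x _; exact: epow_ge0.
  + exact: (measurable_funTS mw).
  + apply: measurable_funTS.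
    exact: (measurable_epow (L0_normc_scale l Lg) (measurable_cst _) (fun=> a1)).
  + move=> x _; apply: le_epow => //; rewrite divr_ge0 ?normc_ge0//=.
    apply: ler_wpM2l; first exact: normc_ge0.
    by rewrite lef_pV2 ?posrE// ltW// -lte_fin.
- by [].
Qed.

(** For finite alpha, the factor rho^(-d/alpha) raised to the power alpha cancels
    the Jacobian rho^d. For alpha = oo nothing compensates the Jacobian, but the
    integral to be multiplied is 0. *)
Lemma integral_St_le alpha (rho : R) g : 1 <= alpha -> (0 < rho)%R -> L0 g ->
  \int[mu]_x epow (Normc.normc (g x) / 2) alpha <= 2%:E ->
  \int[mu]_x epow (Normc.normc (St alpha rho g x) / 2) alpha <= 2%:E.
Proof.
move=> a1 rho0 Lg gle.
have mg := L0_normc_scale 2 Lg.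
pose w (x : Rd R d) := epow (Normc.normc (g x) / 2) alpha.
have mw : measurable_fun [set: Rd R d] w.
  exact: (measurable_epow mg (measurable_cst _) (fun=> a1)).
have w0 x : 0 <= w x by exact: epow_ge0.
have St_normc x : Normc.normc (St alpha rho g x) =
    (rho `^ (- dim_over d alpha) * Normc.normc (g (rho^-1 *: x)))%R.
  by rewrite /St Normc.normcM normc_real// powR_ge0.
have rhod0 : (0 < rho ^+ d)%R by exact: exprn_gt0.
have wE x : w x = epow (Normc.normc (g x) / 2) alpha by [].
clearbody w; case: alpha a1 gle St_normc wE => [s| |] a1 gle St_normc wE.
- have s0 : (0 < s)%R by rewrite -lte_fin; exact: lt_le_trans a1.
  have E x : epow (Normc.normc (St s%:E rho g x) / 2) s%:E =
      (rho ^+ d)^-1%:E * w (rho^-1 *: x)%R.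
    rewrite St_normc wE /= -EFinM; congr EFin.
    rewrite -mulrA powRM ?powR_ge0 ?divr_ge0 ?normc_ge0//; congr (_ * _)%R.
    by rewrite -powRrM mulNr divfK ?gt_eqF// powRN powR_mulrn// ltW.
  under eq_integral => x _ do rewrite E.
  rewrite ge0_integralZl; last 4 first.
  + exact: measurableT.
  + exact: (measurableT_comp mw (@measurable_dilate R d rho rho0)).
  + by move=> x _; exact: w0.
  + by rewrite lee_fin invr_ge0 ltW.
  rewrite integral_dilate// muleA -EFinM mulVf ?gt_eqF// mul1e.
  by under eq_integral => x _ do rewrite wE.
- have w_int0 : \int[mu]_x w x = 0.
    by under eq_integral => x _ do rewrite wE;
    apply: integral_epow_infty0 => //; apply: le_lt_trans gle _; exact: ltry.
  have E x : epow (Normc.normc (St +oo rho g x) / 2) +oo = w (rho^-1 *: x)%R.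
    by rewrite St_normc wE /= oppr0 powRr0 mul1r.
  under eq_integral => x _ do rewrite E.
  by rewrite integral_dilate// w_int0 mule0.
- by [].
Qed.

Lemma integral_normc_St_le p q alpha (rho : R) g (Q : set V) :
  variable_exponent p -> 1 <= q -> q <= alpha ->
  (\forall x \ae mu, alpha <= p x) -> L0 g -> amalgam_norm p q g <= 1 ->
  (0 < rho)%R -> measurable (Q : set (Rd R d)) ->
  \int[mu]_(x in Q) (Normc.normc (St alpha rho g x))%:E <=
  2%:E * (mu Q + 2%:E).
Proof.
move=> hp q1 qa ap Lg g1 rho0 mQ; have a1 : 1 <= alpha by exact: le_trans qa.
have LS : L0 (St alpha rho g) by exact: L0_St.
have S2 := integral_St_le a1 rho0 Lg (integral_amalgam hp q1 qa ap Lg g1).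
apply: le_trans (integral_normc_le_modular mQ LS (variable_exponent_cst a1) _) _.
  exact: (ltr0n R 2).
apply: lee_wpmul2l => //; apply: leeD => //; apply: le_trans S2.
apply: ge0_subset_integral; [exact: mQ|exact: measurableT| | |exact: subsetT].
- exact: (measurable_epow (L0_normc_scale 2 LS) (measurable_cst _) (fun=> a1)).
- by move=> x _; exact: epow_ge0.
Qed.

End Dilates.

(** * Operations on decompositions *)

Section Decompositions.
Local Open Scope complex_scope.
Local Open Scope ring_scope.
Local Open Scope ereal_scope.
Context {R : realType} {d : nat} {p : 'rV[R]_d -> \bar R} {q alpha : \bar R}.
Hypothesis hp : variable_exponent p.
Hypothesis hq : 1 <= q.
Local Notation V := 'rV[R]_d.
Local Notation mu := (@lebesgueRd R d).
Implicit Types (f g : V -> R[i]) (c : nat -> R[i]) (rho : nat -> R)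
  (fn : nat -> V -> R[i]).

Definition remainder f c rho fn (N : nat) : V -> R[i] := fun x =>
  (f x - \sum_(0 <= n < N) c n * St alpha (rho n) (fn n) x)%R.

Lemma L0_partial_sum c rho fn (N : nat) : (forall n, 0 < rho n)%R ->
  (forall n, L0 (fn n)) ->
  L0 (fun x => \sum_(0 <= n < N) c n * St alpha (rho n) (fn n) x)%R.
Proof.
move=> rho0 Lfn; apply: (@L0_sum _ _ (fun n x => c n * St alpha (rho n) (fn n) x)%R).
by move=> n; exact: (L0M (L0_cst _) (L0_St _ (rho0 n) (Lfn n))).
Qed.

Lemma L0_remainder f c rho fn (N : nat) : L0 f -> (forall n, 0 < rho n)%R ->
  (forall n, L0 (fn n)) -> L0 (remainder f c rho fn N).
Proof.
move=> Lf rho0 Lfn; apply: (L0D Lf).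
rewrite (_ : (fun x => _) = (fun x => (-1) *
  \sum_(0 <= n < N) c n * St alpha (rho n) (fn n) x)%R); last first.
  by apply/funext => x; rewrite mulN1r.
exact: (L0M (L0_cst _) (L0_partial_sum c N rho0 Lfn)).
Qed.

Lemma abs_sum_ge0 c : 0 <= abs_sum c.
Proof. by apply: nneseries_ge0 => n _ _; rewrite lee_fin normc_ge0. Qed.

Lemma sigma_ge0 f : 0 <= sigma p q alpha f.
Proof.
by apply: le_ereal_inf_tmp => _ [_ [c [rho [fn [_ ->]]]]]; exact: abs_sum_ge0.
Qed.

Definition multiplier f g : V -> R[i] := fun x =>
  if (Normc.normc (f x) <= Normc.normc (g x))%R then (f x / g x)%R else 0%R.

Lemma L0_multiplier f g : L0 f -> L0 g -> L0 (multiplier f g).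
Proof.
move=> Lf Lg; apply: L0_if; last exact: L0_cst.
  by apply: measurable_fun_ler; exact: L0_normc.
exact: (L0M Lf (L0_inv Lg)).
Qed.

Lemma normc_multiplier_le1 f g x : (Normc.normc (multiplier f g x) <= 1)%R.
Proof.
rewrite /multiplier; case: ifPn => [fg|_]; last by rewrite Normc.normc0 ler01.
rewrite Normc.normcM Normc.normcV.
have := normc_ge0 (g x); rewrite le_eqVlt => /predU1P[<-|g0].
  by rewrite invr0 mulr0 ler01.
by rewrite ler_pdivrMr// mul1r.
Qed.

Lemma multiplierK f g x : (Normc.normc (f x) <= Normc.normc (g x))%R ->
  (multiplier f g x * g x)%R = f x.
Proof.
move=> fg; rewrite /multiplier fg; have [g0|g0] := eqVneq (g x) 0%R.
  move: fg; rewrite g0 Normc.normc0 => f0.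
  have {}f0 : Normc.normc (f x) = 0%R by apply/eqP; rewrite eq_le f0 normc_ge0.
  by rewrite (Normc.eq0_normc f0) mul0r mul0r.
by rewrite divfK.
Qed.

(** Multiplying by m before or after a dilation differs by a dilation of m, so
    m can be moved into each term; the remainders are multiplied by m too. *)
Lemma h_decomposition_le f g c rho fn : L0 f -> L0 g ->
  (\forall x \ae mu, Normc.normc (f x) <= Normc.normc (g x))%R ->
  h_decomposition p q alpha g c rho fn ->
  exists fn', h_decomposition p q alpha f c rho fn'.
Proof.
move=> Lf Lg fg [rho0 fnA cfin cvg].
pose m := multiplier f g; have Lm : L0 m by exact: L0_multiplier.
have Lfn n : L0 (fn n) by have [[[]]] := fnA n.
pose fn' n x := (m (rho n *: x) * fn n x)%R.
have Lfn' n : L0 (fn' n).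
  apply: (L0M _ (Lfn n)); rewrite -[rho n]invrK; apply: L0_dilate => //.
  by rewrite invr_gt0.
have StE n x : St alpha (rho n) (fn' n) x = (m x * St alpha (rho n) (fn n) x)%R.
  rewrite /St /fn' scalerA divff ?gt_eqF// scale1r.
  by rewrite mulrCA mulrA.
exists fn'; split; [exact: rho0|move=> n|exact: cfin|].
  have [fnn fn1] := fnA n.
  have [] := amalgam_le hp hq (Lfn' n) fnn.
    move=> x; rewrite /fn' Normc.normcM ler_piMl ?normc_ge0//.
    exact: normc_multiplier_le1.
  by move=> fn'A fn'_le; split; [exact: fn'A|exact: le_trans fn'_le fn1].
apply: (@local_cvg0_le _ _ _ hp (remainder f c rho fn') (remainder g c rho fn)).
- by move=> N; exact: L0_remainder.
- by move=> N; exact: L0_remainder.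
- move=> N; apply: ae_imply fg => x fgx.
  rewrite /remainder -[f x](multiplierK fgx) -/(m x).
  under eq_bigr => n _ do rewrite StE mulrCA.
  rewrite -mulr_sumr -mulrBr Normc.normcM ler_piMl ?normc_ge0//.
  exact: normc_multiplier_le1.
- exact: cvg.
Qed.

Lemma sigma_le_normc f g : L0 f -> L0 g ->
  (\forall x \ae mu, Normc.normc (f x) <= Normc.normc (g x))%R ->
  sigma p q alpha f <= sigma p q alpha g.
Proof.
move=> Lf Lg fg; apply: le_ereal_inf_tmp => _ [gloc [c [rho [fn [dec ->]]]]].
apply: ereal_inf_lbound; split; first exact: Lp_loc_le gloc fg.
have [fn' dec'] := h_decomposition_le Lf Lg fg dec.
by exists c, rho, fn'.
Qed.

Lemma sigma_ae0 f : L0 f -> (\forall x \ae mu, f x = 0%R) ->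
  sigma p q alpha f = 0.
Proof.
move=> Lf f0; apply/eqP; rewrite eq_le sigma_ge0 andbT.
have [am0 norm0] := @amalgam0 R d p q hp hq.
apply: (@le_trans _ _ (sigma p q alpha (fun=> 0%R))).
  apply: sigma_le_normc => //.
  by apply: ae_imply f0 => x ->.
apply: ereal_inf_lbound; split; first exact: am0.1.
exists (fun=> 0%R), (fun=> 1%R), (fun _ _ => 0%R); split; last first.
  by rewrite /abs_sum eseries0// => n _ _; rewrite Normc.normc0.
split; first by move=> n; exact: ltr01.
- by move=> n; split; [exact: am0|rewrite norm0 lee01].
- by rewrite /abs_sum eseries0// => n _ _; rewrite Normc.normc0.
- move=> K _; rewrite (_ : (fun N => _) = (fun=> 0)); first exact: cvg_cst.
  apply/funext => N; rewrite -[RHS](@vnorm0 R d p hp) -(cut0 K).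
  congr (vnorm p (cut K _)); apply/funext => x.
  by rewrite cut0 big1 ?subr0// => n _; rewrite mul0r.
Qed.

Lemma sigma_scale_le f (l : R) : (0 < l)%R ->
  sigma p q alpha (fun x => l%:C * f x)%C%R <= l%:E * sigma p q alpha f.
Proof.
move=> l0; apply: le_mul_ereal_inf => // _ [floc [c [rho [fn [dec ->]]]]].
have [rho0 fnA cfin cvg] := dec.
have sumE : abs_sum (fun n => l%:C * c n)%C%R = l%:E * abs_sum c.
  rewrite /abs_sum -nneseriesZl; last by move=> n _; rewrite lee_fin normc_ge0.
  by apply: eq_eseriesr => n _; rewrite Normc.normcM normc_real ?ltW.
apply: ereal_inf_lbound; split; first by apply: Lp_loc_scale => //; exact: ltW.
exists (fun n => l%:C * c n)%C%R, rho, fn; split; last exact: (esym sumE).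
split; [exact: rho0|exact: fnA| |].
  by rewrite sumE lte_mul_pinfty// lee_fin ltW.
have := local_cvg0_scale hp l%:C%C cvg; congr local_cvg0.
apply/funext => N; apply/funext => x.
by rewrite mulrBr mulr_sumr; under eq_bigr => n _ do rewrite mulrA.
Qed.

(** For l > 0 the reverse inequality is the direct one for l^-1 applied to
    l f. *)
Lemma sigma_scale f (l : R) : L0 f -> (0 <= l)%R ->
  sigma p q alpha (fun x => l%:C * f x)%C%R = l%:E * sigma p q alpha f.
Proof.
move=> Lf; rewrite le_eqVlt => /predU1P[<-|l0].
  rewrite mul0e; apply: sigma_ae0; first exact: (L0M (L0_cst _) Lf).
  by apply: aeW => x; rewrite mul0r.
apply/eqP; rewrite eq_le sigma_scale_le//=.
have li0 : (0 < l^-1)%R by rewrite invr_gt0.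
have := sigma_scale_le (fun x => l%:C * f x)%C%R li0.
rewrite (_ : (fun x => _) = f); last first.
  by apply/funext => x; rewrite mulrA -rmorphM mulVf ?gt_eqF// mul1r.
move=> /(@lee_wpmul2l _ l%:E); rewrite lee_fin (ltW l0) => /(_ isT).
by rewrite muleA -EFinM divff ?gt_eqF// mul1e.
Qed.

Definition interleave (T : Type) (a b : nat -> T) (n : nat) : T :=
  if odd n then b n./2 else a n./2.

Lemma sum_interleave (W : nmodType) (a b : nat -> W) (N : nat) :
  (\sum_(0 <= n < N) interleave a b n =
   \sum_(0 <= n < uphalf N) a n + \sum_(0 <= n < N./2) b n)%R.
Proof.
elim: N => [|N IH]; first by rewrite !big_nil addr0.
rewrite big_nat_recr//= IH /interleave uphalf_half.
case: (odd N); rewrite /= ?add1n ?add0n ?addn0.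
  by rewrite [X in (_ = _ + X)%R]big_nat_recr//= addrA.
by rewrite [X in (_ = X + _)%R]big_nat_recr//= addrAC.
Qed.

(** The N-th remainder of the interleaved decomposition is the sum of the
    remainders of index uphalf N and N./2 of the two given ones. *)
Lemma h_decompositionD f g c rho fn c' rho' gn : L0 f -> L0 g ->
  h_decomposition p q alpha f c rho fn ->
  h_decomposition p q alpha g c' rho' gn ->
  abs_sum (interleave c c') <= abs_sum c + abs_sum c' /\
  h_decomposition p q alpha (fun x => f x + g x)%R
    (interleave c c') (interleave rho rho') (interleave fn gn).
Proof.
move=> Lf Lg [rho0 fnA cfin cvg] [rho'0 gnA c'fin cvg'].
have sum_le : abs_sum (interleave c c') <= abs_sum c + abs_sum c'.
  rewrite {1}/abs_sum; apply: lime_le.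
    by apply: is_cvg_nneseries => n _ _; rewrite lee_fin normc_ge0.
  apply: nearW => N.
  rewrite (eq_bigr (interleave (fun n => (Normc.normc (c n))%:E)
     (fun n => (Normc.normc (c' n))%:E))); last first.
    by move=> n _; rewrite /interleave; case: odd.
  rewrite sum_interleave; apply: leeD;
    by apply: nneseries_lim_ge => n _ _; rewrite lee_fin normc_ge0.
split; first exact: sum_le.
split.
- by move=> n; rewrite /interleave; case: odd.
- by move=> n; rewrite /interleave; case: odd.
- by apply: le_lt_trans sum_le _; rewrite lte_add_pinfty.
have Lfn n : L0 (fn n) by have [[[]]] := fnA n.
have Lgn n : L0 (gn n) by have [[[]]] := gnA n.
have := @local_cvg0D _ _ _ hp (remainder f c rho fn) (remainder g c' rho' gn).
move=> /(_ (fun N => L0_remainder _ N Lf rho0 Lfn)).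
move=> /(_ (fun N => L0_remainder _ N Lg rho'0 Lgn) cvg cvg').
congr local_cvg0; apply/funext => N; apply/funext => x.
rewrite /remainder addrACA -opprD; congr (_ - _)%R.
rewrite -sum_interleave; apply: eq_bigr => n _.
by rewrite /interleave; case: odd.
Qed.

Lemma sigmaD f g : L0 f -> L0 g ->
  sigma p q alpha (fun x => f x + g x)%R <=
  sigma p q alpha f + sigma p q alpha g.
Proof.
move=> Lf Lg.
have [->|foo] := eqVneq (sigma p q alpha f) +oo.
  by rewrite addye ?leey// gt_eqF// (lt_le_trans _ (sigma_ge0 g)) ?ltNyr.
have [->|goo] := eqVneq (sigma p q alpha g) +oo.
  by rewrite addey ?leey// gt_eqF// (lt_le_trans _ (sigma_ge0 f)) ?ltNyr.
have ffin : sigma p q alpha f \is a fin_num.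
  rewrite (ge0_fin_numE (sigma_ge0 f)) ltey; exact: foo.
have gfin : sigma p q alpha g \is a fin_num.
  rewrite (ge0_fin_numE (sigma_ge0 g)) ltey; exact: goo.
apply/lee_addgt0Pr => e e0; have e20 : (0 < e / 2)%R by rewrite divr_gt0.
have [_ [floc [c [rho [fn [dec ->]]]]] clt] := lb_ereal_inf_adherent e20 ffin.
have [_ [gloc [c' [rho' [gn [dec' ->]]]]] c'lt] := lb_ereal_inf_adherent e20 gfin.
have [sum_le decD] := h_decompositionD Lf Lg dec dec'.
apply: (@le_trans _ _ (abs_sum (interleave c c'))).
  apply: ereal_inf_lbound; split; first exact: (Lp_locD hp floc gloc).
  by exists (interleave c c'), (interleave rho rho'), (interleave fn gn); split; first exact: decD.
apply: (le_trans sum_le); apply: le_trans (leeD (ltW clt) (ltW c'lt)) _.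
by rewrite addeACA -EFinD -splitr.
Qed.

Hypothesis hqalpha : q <= alpha.
Hypothesis halphap : \forall x \ae mu, alpha <= p x.

Let measurable_normc (Q : set V) f : L0 f ->
  measurable_fun (Q : set (Rd R d)) (fun x => (Normc.normc (f x))%:E).
Proof.
by move=> Lf; apply: measurable_funTS; apply/measurable_EFinP; exact: L0_normc.
Qed.

(** The constant involves neither N nor the dilations, since each dilate has the
    same bound on its integral over Q. *)
Lemma integral_partial_sum_le (Q : set V) c rho fn (N : nat) :
  measurable (Q : set (Rd R d)) -> (forall n, 0 < rho n)%R ->
  (forall n, L0 (fn n)) -> (forall n, amalgam_norm p q (fn n) <= 1) ->
  \int[mu]_(x in Q) (Normc.normc
    (\sum_(0 <= n < N) c n * St alpha (rho n) (fn n) x)%R)%:E <=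
  2%:E * (mu Q + 2%:E) * abs_sum c.
Proof.
move=> mQ rho0 Lfn fn1; set C := 2%:E * _.
have C0 : 0 <= C by rewrite mule_ge0// adde_ge0.
have mSt n : measurable_fun (Q : set (Rd R d))
    (fun x => (Normc.normc (St alpha (rho n) (fn n) x))%:E).
  exact: measurable_normc (L0_St _ (rho0 n) (Lfn n)).
have mcSt n : measurable_fun (Q : set (Rd R d)) (fun x =>
    (Normc.normc (c n))%:E * (Normc.normc (St alpha (rho n) (fn n) x))%:E).
  exact: emeasurable_funM (measurable_cst _) (mSt n).
apply: (@le_trans _ _ (\int[mu]_(x in Q) \sum_(0 <= n < N)
    ((Normc.normc (c n))%:E * (Normc.normc (St alpha (rho n) (fn n) x))%:E))).
  apply: ge0_le_integral; first exact: mQ.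
  - by move=> x _; rewrite lee_fin normc_ge0.
  - exact: measurable_normc (L0_partial_sum c N rho0 Lfn).
  - exact: emeasurable_sum.
  move=> x _; elim: N => [|N IH]; first by rewrite !big_nil Normc.normc0.
  rewrite !big_nat_recr//=; apply: (@le_trans _ _ ((Normc.normc
    (\sum_(0 <= n < N) c n * St alpha (rho n) (fn n) x)%R)%:E +
    (Normc.normc (c N * St alpha (rho N) (fn N) x)%R)%:E)).
    by rewrite -EFinD lee_fin; exact: (le_normcD (_ : Rcomplex R) _).
  by apply: leeD => //; rewrite Normc.normcM.
rewrite ge0_integral_sum; [|exact: mQ|exact: mcSt|]; last first.
  by move=> n x _; rewrite mule_ge0 ?lee_fin ?normc_ge0.
apply: (@le_trans _ _ (C * \sum_(0 <= n < N) (Normc.normc (c n))%:E)).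
  rewrite ge0_sume_distrr; last by move=> n _; rewrite lee_fin normc_ge0.
  apply: lee_sum => n _.
  rewrite ge0_integralZl; [|exact: mQ|exact: mSt| |]; last 2 first.
  - by move=> x _; rewrite lee_fin normc_ge0.
  - by rewrite lee_fin normc_ge0.
  rewrite muleC; apply: lee_wpmul2r; first by rewrite lee_fin normc_ge0.
  exact: (integral_normc_St_le hp hq hqalpha halphap (Lfn n) (fn1 n)).
apply: lee_wpmul2l; first exact: C0.
by apply: nneseries_lim_ge => n _ _; rewrite lee_fin normc_ge0.
Qed.

(** Splitting f into a partial sum and a remainder bounds the integral by the
    announced constant plus the integral of the remainder, which is small
    because the norm controls the integral over a bounded box. *)
Lemma h_decomposition_L1 f c rho fn (m : nat) : L0 f ->
  h_decomposition p q alpha f c rho fn ->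
  \int[mu]_(x in centered_box m) (Normc.normc (f x))%:E <=
  2%:E * (mu (centered_box m) + 2%:E) * abs_sum c.
Proof.
move=> Lf [rho0 fnA cfin cvg]; set Q := centered_box m.
have mQ : measurable (Q : set (Rd R d)) by exact: measurable_centered_box.
have Qfin : mu Q \is a fin_num.
  rewrite ge0_fin_numE; first exact: lebesgueRd_centered_box.
  exact: measure_ge0.
have Lfn n : L0 (fn n) by have [[[]]] := fnA n.
apply/lee_addgt0Pr => e e0.
(* a norm below e / M gives an integral of at most (e / M) (mu Q + 1) = e *)
pose M := (fine (mu Q) + 1)%R.
have M0 : (0 < M)%R by rewrite ltr_wpDl// fine_ge0.
have [N hN] := (local_cvg0P hp _).1 cvg m _ (divr_gt0 e0 M0).
have LR := L0_remainder c N Lf rho0 Lfn.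
have rem_le : \int[mu]_(x in Q) (Normc.normc (remainder f c rho fn N x))%:E <= e%:E.
  apply: le_trans (integral_normc_le_cut mQ LR hp (divr_gt0 e0 M0)
    (hN N (leqnn N))) _.
  by rewrite -(fineK Qfin) -EFinD -EFinM lee_fin divfK ?gt_eqF.
have mS := measurable_normc (Q := Q) (L0_partial_sum c N rho0 Lfn).
have mR := measurable_normc (Q := Q) LR.
apply: (@le_trans _ _ (\int[mu]_(x in Q)
   ((Normc.normc (\sum_(0 <= n < N) c n * St alpha (rho n) (fn n) x)%R)%:E +
    (Normc.normc (remainder f c rho fn N x))%:E))).
  apply: ge0_le_integral; first exact: mQ.
  - by move=> x _; rewrite lee_fin normc_ge0.
  - exact: measurable_normc.
  - exact: emeasurable_funD mS mR.
  move=> x _; rewrite -EFinD lee_fin.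
  rewrite -{1}[f x](subrK (\sum_(0 <= n < N) c n * St alpha (rho n) (fn n) x)%R).
  by rewrite addrC; exact: (le_normcD (_ : Rcomplex R) _).
rewrite (ge0_integralD _ mQ _ mS _ mR);
  [|by move=> x _; rewrite lee_fin normc_ge0..].
apply: leeD; last exact: rem_le.
by apply: integral_partial_sum_le mQ rho0 Lfn _ => n; exact: (fnA n).2.
Qed.

Lemma sigma_eq0_ae f : L0 f -> sigma p q alpha f = 0 ->
  \forall x \ae mu, f x = 0%R.
Proof.
move=> Lf sf0.
have int0 m : \int[mu]_(x in centered_box m) (Normc.normc (f x))%:E = 0.
  apply/eqP; rewrite eq_le integral_ge0 ?andbT; last first.
    by move=> x _; rewrite lee_fin normc_ge0.
  have : \int[mu]_(x in centered_box m) (Normc.normc (f x))%:E <=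
      (fine (2%:E * (mu (centered_box m) + 2%:E)))%:E * sigma p q alpha f.
    have Cfin : 2%:E * (mu (centered_box m) + 2%:E) \is a fin_num.
      rewrite fin_numM// fin_numD andbT ge0_fin_numE ?measure_ge0//.
      exact: lebesgueRd_centered_box.
    apply: le_mul_ereal_inf.
      rewrite -lte_fin fineK// mule_gt0//.
      by rewrite (@lt_le_trans _ _ 2%:E)// leeDr// measure_ge0.
    move=> _ [_ [c [rho [fn [dec ->]]]]]; rewrite fineK//.
    exact: h_decomposition_L1 dec.
  by rewrite sf0 mule0.
have aem m : \forall x \ae mu, centered_box m x -> f x = 0%R.
  have mQ := @measurable_centered_box R d m.
  have mf : measurable_fun (centered_box m : set (Rd R d))
      (fun x => (Normc.normc (f x))%:E).
    by apply: measurable_funTS; apply/measurable_EFinP; exact: L0_normc.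
  have [+ _] := ae_eq_integral_abs mu mQ mf.
  under eq_integral => x _ do rewrite gee0_abs ?lee_fin ?normc_ge0//.
  move=> /(_ (int0 m)); apply: ae_imply => x h /h[] /Normc.eq0_normc.
  by [].
have := ae_foralln aem; apply: ae_imply => x h.
by have [m xm] := centered_box_cover x; exact: h xm.
Qed.

End Decompositions.

(** * The function norm and its Koethe space *)

Lemma ge0_le_normc (R : realType) (z w : R[i]) :
  (0 <= z)%R -> (z <= w)%R -> (Normc.normc z <= Normc.normc w)%R.
Proof.
move=> z0 zw; rewrite -lecR -!normc_norm !ger0_norm//.
exact: le_trans zw.
Qed.

Theorem corollary4p2 (R : realType) (d : nat) (hd : (0 < d)%N)
  (p : 'rV[R]_d -> \bar R) (q alpha : \bar R)
  (hp : variable_exponent p)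
  (hq : 1 <= q) (hqalpha : q <= alpha)
  (halphap : \forall x \ae @lebesgueRd R d, alpha <= p x) :
  function_norm (sigma p q alpha) /\
  Hspace p q alpha = koethe_space (sigma p q alpha).
Proof.
split.
  split.
  - by move=> f _; exact: sigma_ge0.
  - move=> f g [Lf _] [Lg _] fg; apply/eqP; rewrite eq_le; apply/andP; split.
      by apply: (sigma_le_normc hp hq Lf Lg); apply: ae_imply fg => x ->.
    by apply: (sigma_le_normc hp hq Lg Lf); apply: ae_imply fg => x ->.
  - move=> f [Lf _]; split; last exact: sigma_ae0.
    exact: (sigma_eq0_ae hp hq hqalpha halphap Lf).
  - by move=> f l [Lf _] l0; exact: sigma_scale.
  - by move=> f g [Lf _] [Lg _]; exact: sigmaD.
  - move=> f g [Lf f0] [Lg g0] fg; apply: (sigma_le_normc hp hq Lf Lg).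
    by apply: ae_imply2 f0 fg => x; exact: ge0_le_normc.
have L0_abs (f : 'rV[R]_d -> R[i]) : L0 f -> L0 (fun x => `|f x|%R).
  by move=> Lf; under eq_fun do rewrite normc_norm; exact/L0_real/L0_normc.
have normc_abs (f : 'rV[R]_d -> R[i]) x :
    Normc.normc `|f x|%R = Normc.normc (f x).
  by rewrite normc_norm normc_real// normc_ge0.
apply/seteqP; split => [f [floc [c [rho [fn dec]]]]|f [Lf fabs]].
  have Lf : L0 f := floc.1; split=> //.
  apply: (@le_lt_trans _ _ (sigma p q alpha f)).
    by apply: (sigma_le_normc hp hq (L0_abs f Lf) Lf); apply: aeW => x;
      rewrite normc_abs.
  apply: (@le_lt_trans _ _ (abs_sum c)); last by case: dec.
  by apply: ereal_inf_lbound; split; [exact: floc|exists c, rho, fn].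
have : sigma p q alpha f < +oo.
  apply: le_lt_trans fabs; apply: (sigma_le_normc hp hq Lf (L0_abs f Lf)).
  by apply: aeW => x; rewrite normc_abs.
move=> /ereal_inf_lt[_ [floc [c [rho [fn [dec _]]]]] _].
by split; [exact: floc|exists c, rho, fn].
Qed.
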